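(* Let $(\epsilon_k)_{k\geq2}$ be a sequence of positive numbers with $\epsilon_k\downarrow0$, and set $$\sigma_k=\frac{k}{\sqrt{2\log k}\,(1-\mathrm{e}^{-k^2\epsilon_k})},\qquad k\geq2 .$$ Let $\xi_k\sim\mathcal{N}(0,\sigma_k^2)$, $k\geq 2$, be independent real Gaussian random variables and $\Xi(x)=\sum_{k\ge2}\xi_k\sin kx$. Consider the problem described in the context with initial values $\xi_k(0)=\xi_k$ for $k\geq2$ and $\xi_1(0)=0$, with associated blow-up times $\tau_k$. Then, almost surely, $\tau_k\leq\epsilon_k$ for infinitely many $k$. In particular $\inf_k\tau_k=0$ almost surely and, with probability one, there is no solution of the problem with this initial condition (on any time interval $[0,T]$, $T>0$). Moreover, if $\inf_kk^2\epsilon_k>0$, then $\Xi\in\mathscr{C}^{-\frac32-}$ almost surely.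
   Context: Consider on $[-\pi,\pi]$, with periodic boundary conditions and zero mean, the problem $$\partial_tu=u_{xx}+(u\star u)_x,\qquad u\text{ odd},$$ where $\star$ denotes convolution on $(-\pi,\pi)$ (normalized so that the $k$-th Fourier coefficient of $u\star u$ is $u_k^2$). Writing $u(x)=\sum_{k\in\mathbf{Z}}u_k\mathrm{e}^{\mathrm{i}kx}$ with $u_k=-\mathrm{i}\xi_k$, $\xi_k\in\mathbf{R}$, $\xi_{-k}=-\xi_k$, the equation is equivalent to $$\frac{d}{dt}\xi_k=-k^2\xi_k+k\xi_k^2,\qquad k\geq1,$$ and a solution on $[0,T]$ is understood in this sense, i.e. every Fourier component solves its equation on $[0,T]$ with the prescribed initial value. For each $k\ge1$ set $$\tau_k=-\frac1{k^2}\log\Bigl(1-\frac{k^2}{k\,\xi_k(0)}\Bigr),$$ with $\tau_k=\infty$ if the argument of the logarithm is not positive or undefined, or if the formula gives a negative number; $\tau_k$ is the (forward) blow-up time of the $k$-th component, and $\tau_k<\infty$ when $\xi_k(0)>k$. $\mathscr{C}^s=B^s_{\infty,\infty}$ on the one-dimensional torus, and $\mathscr{C}^{-\frac32-}$ means belonging to $\mathscr{C}^{s}$ for every $s<-\frac32$. *)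

(* Defs.v *)
From mathcomp Require Import all_boot all_order all_algebra.
From mathcomp Require Import all_classical all_reals all_analysis.
From mathcomp Require Import ring lra.

Set Implicit Arguments.
Unset Strict Implicit.
Unset Printing Implicit Defensive.

Import Order.TTheory GRing.Theory Num.Theory.
Import numFieldNormedType.Exports.

Local Open Scope classical_set_scope.
Local Open Scope ring_scope.

Definition mutually_independent d (T : measurableType d) (R : realType)
    (P : probability T R) (D : set nat) (X : nat -> {RV P >-> R}) : Prop :=
  forall (s : seq nat) (B : nat -> set R),
    uniq s -> (forall k, k \in s -> D k) -> (forall k, measurable (B k)) ->
    (P (\bigcap_(k in [set` s]) (X k @^-1` B k)) =
     \prod_(k <- s) P (X k @^-1` B k))%E.

Section Problem.
Variable R : realType.
Implicit Types (k : nat) (x t T : R).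

Definition sigma (eps : nat -> R) k : R :=
  k%:R / (Num.sqrt (2 * ln k%:R) * (1 - expR (- (k%:R ^+ 2 * eps k)))).

(* Blow-up time of y' = - k^2 y + k y^2, y 0 = x. *)
Definition blowup_time k x : \bar R :=
  let a := 1 - k%:R ^+ 2 / (k%:R * x) in
  let t := - (k%:R ^+ 2)^-1 * ln a in
  if (k%:R * x == 0) || (a <= 0) || (t < 0) then +oo%E else t%:E.

(* Derivative relative to [0, T], hence one-sided at the endpoints. *)
Definition derives_on T (f g : R -> R) : Prop :=
  forall t, t \in `[0, T] ->
    (f s - f t) / (s - t) @[s --> within `[0, T] t^'] --> g t.

(* u_t = u_xx + (u * u)_x (convolution normalised so that (u * u)_k = u_k^2)
   for odd u, in terms of its Fourier coefficients u_k = - i xi_k, k >= 1. *)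
Definition solution T (xi0 : nat -> R) (xi : nat -> R -> R) : Prop :=
  forall k, (0 < k)%N ->
    xi k 0 = xi0 k /\
    derives_on T (xi k)
      (fun t => - k%:R ^+ 2 * xi k t + k%:R * xi k t ^+ 2).

(* A formal real Fourier series
   \sum_k (cos_coef k * cos (k x) + sin_coef k * sin (k x)). *)
Record fourier_series := FourierSeries {
  cos_coef : nat -> R;
  sin_coef : nat -> R }.

(* The formal Fourier series with coefficients of at most polynomial growth
   are exactly those which converge to a (real) periodic distribution. *)
Definition is_distribution (u : fourier_series) : Prop :=
  exists C N, forall k,
    `|cos_coef u k| <= C * k.+1%:R ^+ N /\
    `|sin_coef u k| <= C * k.+1%:R ^+ N.

Definition smooth (f : R -> R) : Prop := forall n x, derivable (derive1n n f) x 1.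

Record dyadic_partition (chi rho : R -> R) : Prop := DyadicPartition {
  chi_smooth : smooth chi;
  rho_smooth : smooth rho;
  chi_even : forall x, chi (- x) = chi x;
  rho_even : forall x, rho (- x) = rho x;
  chi_itv : forall x, 0 <= chi x <= 1;
  rho_itv : forall x, 0 <= rho x <= 1;
  chi_supp : forall x, 4 / 3 <= `|x| -> chi x = 0;
  rho_supp : forall x, `|x| <= 3 / 4 \/ 8 / 3 <= `|x| -> rho x = 0;
  chi_rho1 : forall x,
    chi x + \sum_(0 <= j < n) rho (x / 2 ^+ j) @[n --> \oo] --> (1 : R) }.

(* Littlewood-Paley blocks start at index -1: [lp_weight chi rho j] and
   [lp_block chi rho u j] are the multiplier and the block of index j - 1. *)
Definition lp_weight (chi rho : R -> R) (j : nat) : R -> R :=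
  if j is i.+1 then fun x => rho (x / 2 ^+ i) else chi.

(* The multiplier of index j - 1 vanishes at every k >= 2 ^ j.+1, so the sum
   contains all the non-zero terms. *)
Definition lp_block (chi rho : R -> R) (u : fourier_series) (j : nat) x : R :=
  \sum_(k < 2 ^ j.+1) lp_weight chi rho j k%:R *
    (cos_coef u k * cos (k%:R * x) + sin_coef u k * sin (k%:R * x)).

(* Norm of B^s_{oo,oo}; blocks are trigonometric polynomials, so that their
   essential supremum is their supremum. *)
Definition besov_norm (chi rho : R -> R) (s : R) (u : fourier_series) : \bar R :=
  ereal_sup (range (fun j : nat =>
    (2 `^ (s * (j%:R - 1)))%:E *
      ereal_sup (range (fun x => (`|lp_block chi rho u j x|)%:E))))%E.

Definition in_besov (s : R) (u : fourier_series) : Prop :=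
  is_distribution u /\
  forall chi rho, dyadic_partition chi rho -> (besov_norm chi rho s u < +oo)%E.

Definition in_besov_minus (a : R) (u : fourier_series) : Prop :=
  forall s, s < a -> in_besov s u.

Definition sine_series (b : nat -> R) : fourier_series :=
  FourierSeries (fun=> 0) b.

End Problem.

(* Dyadic partitions of unity exist, so that the quantification over them in
   [in_besov] is not vacuous. *)
Section Existence.
Variable R : realType.
Implicit Types (x : R) (f g : R -> R).

(* x ^- n * exp (- 1 / x), extended by 0 to x <= 0. *)
Definition flat n x : R := if 0 < x then x ^- n * expR (- x^-1) else 0.

Lemma flat_0 n : flat n 0 = 0.
Proof. by rewrite /flat ltxx. Qed.

Lemma flat_le0 n x : x <= 0 -> flat n x = 0.
Proof. by move=> x0; rewrite /flat ltNge x0. Qed.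

Lemma flat_gt0 x : 0 < x -> 0 < flat 0 x.
Proof. by move=> x0; rewrite /flat x0 expr0 invr1 mul1r expR_gt0. Qed.

Lemma flat_ge0 x : 0 <= flat 0 x.
Proof. by rewrite /flat; case: ifP; rewrite // expr0 invr1 mul1r expR_ge0. Qed.

Lemma flat_le x y : x <= y -> flat 0 x <= flat 0 y.
Proof.
move=> xy; have [x0|x0] := ltP 0 x; last by rewrite {1}/flat ltNge x0 flat_ge0.
have y0 : 0 < y by exact: lt_le_trans xy.
by rewrite /flat x0 y0 expr0 invr1 !mul1r ler_expR lerN2 lef_pV2.
Qed.

Lemma flat_bound n x : `|flat n x| <= n.+1`!%:R * `|x|.
Proof.
have [x0|x0] := ltP 0 x; last first.
  by rewrite /flat ltNge x0/= normr0 mulr_ge0.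
rewrite /flat x0 ger0_norm; last by rewrite mulr_ge0 ?expR_ge0// invr_ge0 exprn_ge0 ?ltW.
have y0 : 0 < x^-1 by rewrite invr_gt0.
rewrite expRN ler_pdivrMr ?expR_gt0// gtr0_norm//.
apply: le_trans (ler_wpM2l _ (expR_ge1Dxn n (ltW y0))); last by rewrite mulr_ge0// ltW.
have fn : 0 < n.+1`!%:R :> R by rewrite ltr0n fact_gt0.
rewrite mulrDr mulr1 -[leLHS]add0r lerD//; first by rewrite mulr_ge0// ltW.
rewrite le_eqVlt; apply/orP; left; apply/eqP.
by rewrite exprSr exprVn; field; rewrite expf_neq0 ?(gt_eqF fn) ?(gt_eqF x0).
Qed.

Lemma is_derive_flat n x :
  is_derive x 1 (flat n) (- n%:R * flat n.+1 x + flat n.+2 x).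
Proof.
have [x0|x0|x0] := ltgtP x 0.
- apply: (@near_eq_is_derive _ _ _ (cst 0)).
    near=> z; rewrite /flat ltNge ltW//; near: z; exact: lt_nbhsl.
  by rewrite /flat !ltNge ltW//= mulr0 addr0; exact: is_derive_cst.
- apply: (@near_eq_is_derive R R R (fun z : R => z ^- n * expR (- z^-1)) (flat n)).
    near=> z; rewrite /flat ifT//; near: z; exact: lt_nbhsr.
  have xn : x != 0 by rewrite gt_eqF.
  have dx : is_derive x 1 (fun z : R => z) (1:R) by exact: is_derive_id.
  have dv := is_deriveV xn dx.
  have de : is_derive x 1 (fun z : R => expR (- z^-1)) (expR (- x^-1) * (x ^- 2)).
    apply: (@is_derive1_comp _ expR (fun z => - z^-1)).
    apply: is_derive_eq (is_deriveN dv) _.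
    by rewrite /GRing.scale/= mulr1 opprK.
  have dn : is_derive x 1 (fun z : R => z ^- n) (- n%:R * x ^- n.+1).
    have xnn : (fun z : R => z ^+ n) x != 0 by rewrite expf_neq0.
    have dp : is_derive x 1 (fun z : R => z ^+ n) (n%:R * x ^+ n.-1).
      have H := is_deriveX n dx; rewrite exprfctE in H; apply: is_derive_eq H _; by rewrite /GRing.scale/= mulr1.
    have H := @is_deriveV R (fun z : R => z ^+ n) x _ 1 xnn dp; apply: (is_derive_eq H); rewrite /GRing.scale/=.
    case: n {xnn dp H} => [|n]; first by rewrite !mul0r !mulr0 oppr0 mul0r.
    rewrite /= !exprS; field; by rewrite ?expf_neq0 ?xn.
  apply: is_derive_eq (is_deriveM dn de) _; rewrite /GRing.scale/= /flat x0.
  by rewrite !exprS; field; rewrite ?expf_neq0 ?xn.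
- apply/is_derive1_caratheodory; exists (flat n.+1); split.
  + move=> z; rewrite x0 flat_0 !subr0.
    rewrite /flat; case: ifPn => [z0|]; rewrite ?mul0r// exprS.
    by field; rewrite ?expf_neq0 ?gt_eqF.
  + rewrite x0. suff: flat n.+1 z @[z --> (0:R)] --> (0:R) by rewrite /prop_for /continuous_at flat_0. apply/cvgr0Pnorm_le => e e0.
    have fn : 0 < n.+2`!%:R :> R by rewrite ltr0n fact_gt0.
    near=> z; apply: le_trans (flat_bound _ _) _.
    rewrite mulrC -ler_pdivlMr//; near: z.
    have := @cvgr0_norm_le R R _ (nbhs (0:R)) _ id cvg_id.
    by apply; rewrite divr_gt0.
  + by rewrite x0 !flat_0 mulr0 addr0.
Unshelve. all: by end_near. Qed.

(* A class of functions closed under differentiation. *)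
Inductive sm : (R -> R) -> Prop :=
| sm_cst c : sm (cst c)
| sm_id : sm id
| sm_add f g : sm f -> sm g -> sm (fun x => f x + g x)
| sm_mul f g : sm f -> sm g -> sm (fun x => f x * g x)
| sm_inv f : sm f -> (forall x, f x != 0) -> sm (fun x => (f x)^-1)
| sm_flat n f : sm f -> sm (fun x => flat n (f x)).

Lemma sm_derive f : sm f ->
  exists2 f', sm f' & forall x, is_derive x 1 f (f' x).
Proof.
elim=> {f}.
- by move=> c; exists (cst 0); [exact: sm_cst|move=> x; exact: is_derive_cst].
- by exists (cst 1); [exact: sm_cst|move=> x; exact: is_derive_id].
- move=> f g _ [f' sf' df] _ [g' sg' dg].
  exists (fun x => f' x + g' x); first exact: sm_add.
  by move=> x; exact: is_deriveD.
- move=> f g sf [f' sf' df] sg [g' sg' dg].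
  exists (fun x => f x * g' x + g x * f' x).
    by apply: sm_add; exact: sm_mul.
  by move=> x; exact: is_deriveM.
- move=> f sf [f' sf' df] f0.
  exists (fun x => (cst (-1) x * ((f x)^-1 * (f x)^-1)) * f' x).
    apply: sm_mul => //; apply: sm_mul; first exact: sm_cst.
    by apply: sm_mul; exact: sm_inv.
  move=> x; apply: is_derive_eq (is_deriveV (f0 x) (df x)) _.
  by rewrite /GRing.scale/= mulN1r expr2 invfM.
- move=> n f sf [f' sf' df].
  exists (fun x => (cst (- n%:R) x * flat n.+1 (f x) + flat n.+2 (f x)) * f' x).
    apply: sm_mul => //; apply: sm_add; last exact: sm_flat.
    by apply: sm_mul; [exact: sm_cst|exact: sm_flat].
  by move=> x; exact: (is_derive1_comp (is_derive_flat n (f x)) (df x)).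
Qed.

Lemma sm_smooth f : sm f -> smooth f.
Proof.
move=> sf n x; suff /sm_derive[f' _ /(_ x)[]] : sm (derive1n n f) by [].
elim: n => [//|n /sm_derive[f' sf' df]].
rewrite derive1nS; suff -> : (derive1n n f)^`()%classic = f' by [].
by apply/funext => y; rewrite derive1E; case: (df y).
Qed.

Definition cut (u : R) : R :=
  flat 0 (16 / 9 - u) / (flat 0 (16 / 9 - u) + flat 0 (u - 9 / 16)).

Lemma cut_den u : 0 < flat 0 (16 / 9 - u) + flat 0 (u - 9 / 16).
Proof.
have [h|h] := ltP u (16/9).
  by rewrite ltr_wpDr ?flat_ge0// flat_gt0 ?subr_gt0.
by rewrite ltr_wpDl ?flat_ge0// flat_gt0; lra.
Qed.

Lemma cut_itv u : 0 <= cut u <= 1.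
Proof.
have d0 := cut_den u; rewrite /cut; apply/andP; split; first by rewrite divr_ge0 ?flat_ge0 ?ltW.
by rewrite ler_pdivrMr// mul1r lerDl flat_ge0.
Qed.

Lemma cut_anti u v : u <= v -> cut v <= cut u.
Proof.
move=> uv; rewrite /cut ler_pdivrMr ?cut_den// mulrAC ler_pdivlMr ?cut_den//.
rewrite !mulrDr lerD//; first by rewrite mulrC.
by rewrite ler_pM ?flat_ge0// flat_le; lra.
Qed.

Lemma cut1 u : u <= 9 / 16 -> cut u = 1.
Proof.
move=> h; have := cut_den u; rewrite /cut [flat 0 (u - _)]flat_le0 ?addr0; last lra.
by move=> h'; rewrite divff// gt_eqF.
Qed.

Lemma cut0 u : 16 / 9 <= u -> cut u = 0.
Proof. by move=> h; rewrite /cut flat_le0 ?mul0r//; lra. Qed.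

Lemma sm_cut f : sm f -> sm (fun x => cut (f x)).
Proof.
move=> sf.
have sA : sm (fun x => flat 0 (16 / 9 - f x)).
  apply: (@sm_flat 0 (fun x => 16 / 9 - f x)).
  have -> : (fun x => 16 / 9 - f x) = (fun x => cst (16/9) x + cst (-1) x * f x).
    by apply/funext => x /=; rewrite mulN1r.
  by apply: sm_add; [exact: sm_cst|apply: sm_mul => //; exact: sm_cst].
have sB : sm (fun x => flat 0 (f x - 9 / 16)).
  by apply: (@sm_flat 0 (fun x => f x + cst (- (9 / 16)) x)); apply: sm_add => //; exact: sm_cst.
apply: sm_mul => //; apply: sm_inv; first exact: sm_add.
by move=> x; rewrite gt_eqF// cut_den.
Qed.

Lemma dyadic_partition_exists : exists chi rho : R -> R, dyadic_partition chi rho.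
Proof.
pose chi x := cut (x ^+ 2); pose rho x := cut ((x / 2) ^+ 2) - cut (x ^+ 2).
have schi : sm chi.
  by apply: (@sm_cut (fun x => x * x)); apply: sm_mul; exact: sm_id.
have srho : sm rho.
  have -> : rho = (fun x => cut ((x * cst 2^-1 x) * (x * cst 2^-1 x)) + cst (-1) x * cut (x * x)).
    by apply/funext => x; rewrite /rho /= mulN1r !expr2.
  have s2 : sm (fun x => x * cst 2^-1 x) by apply: sm_mul; [exact: sm_id|exact: sm_cst].
  apply: sm_add; first by apply: (@sm_cut (fun x => (x * cst 2^-1 x) * (x * cst 2^-1 x))); exact: sm_mul.
  by apply: sm_mul; [exact: sm_cst|exact: schi].
exists chi, rho; split.
- exact: sm_smooth.
- exact: sm_smooth.
- by move=> x; rewrite /chi sqrrN.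
- by move=> x; rewrite /rho mulNr !sqrrN.
- by move=> x; exact: cut_itv.
- move=> x; have /andP[a0 a1] := cut_itv ((x / 2) ^+ 2).
  have /andP[b0 b1] := cut_itv (x ^+ 2).
  have := @cut_anti ((x / 2) ^+ 2) (x ^+ 2).
  have /[swap] /[apply] : (x / 2) ^+ 2 <= x ^+ 2 by have := sqr_ge0 x; nra.
  by rewrite /rho; lra.
- move=> x hx; apply: cut0; rewrite -real_normK ?num_real//.
  by have := normr_ge0 x; nra.
- move=> x; rewrite /rho -(real_normK (num_real x)) expr_div_n -(real_normK (num_real x)).
  have := normr_ge0 x; set y := `|x|; move=> y0 [h|h].
    by rewrite !cut1 ?subrr//; nra.
  by rewrite !cut0 ?subrr//; nra.
- move=> x.
  have E n : chi x + \sum_(0 <= j < n) rho (x / 2 ^+ j) = chi (x / 2 ^+ n).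
    elim: n => [|n IH]; first by rewrite big_nil addr0 expr0 divr1.
    rewrite big_nat_recr//= addrA IH /rho /chi addrC subrK.
    by rewrite [2 ^+ n.+1]exprSr invfM mulrA.
  rewrite (_ : (fun n => _) = (fun n => chi (x / 2 ^+ n))); last exact/funext.
  apply: cvg_near_cst; near=> n; apply: cut1.
  have two0 : 0 < 2 ^+ n :> R by rewrite exprn_gt0.
  have h : `|x| * 2 <= 2 ^+ n.
    apply: (@le_trans _ _ n%:R); first by near: n; exact: nbhs_infty_ger.
    by rewrite -natrX ler_nat ltnW// ltn_expl.
  rewrite expr_div_n ler_pdivrMr ?exprn_gt0// -(real_normK (num_real x)).
  by have := normr_ge0 x; nra.
Unshelve. all: by end_near. Qed.

End Existence.

(* Main.v *)
Require Import Defs.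
From mathcomp Require Import all_boot all_order all_algebra.
From mathcomp Require Import all_classical all_reals all_analysis.
From mathcomp Require Import measurable_realfun.
From mathcomp Require Import ring lra.

Set Implicit Arguments.
Unset Strict Implicit.
Unset Printing Implicit Defensive.

Import Order.TTheory GRing.Theory Num.Theory.
Import numFieldNormedType.Exports.

Local Open Scope classical_set_scope.
Local Open Scope ring_scope.

(* The event [tau_k <= eps_k] contains [xi_k >= sigma_k (2 log k)^(1/2)], whose
   probability is at least [c / (k log k)]; these events are independent and the
   sum of their probabilities diverges, so almost surely infinitely many occur. A
   mode which blows up before [T] has no solution on [0, T].

   If [k^2 eps_k >= delta > 0], then [sigma_k <= C k], and independence gives
   [E exp (n^(-3/2) sum_(k < n) a_k xi_k) <= exp (C^2 / 2)] whenever
   [|a_k| <= 1]. Summing over [n], and over the points [x] of a polynomially fine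
   grid with [a_k = sin (k x)], shows that almost surely the partial sums of [Xi]
   up to [n] are [O (n^(3/2) log n)] uniformly in [x], which Abel summation turns
   into [O (j 2^(3 j / 2))] for the [j]-th Littlewood-Paley block. *)

(** * Derivatives relative to a closed interval and linear differential equations *)

(** The difference quotient, extended by [g t] at [s = t], is a factor [q] continuous at [t]
    relative to [[0, T]]. This replaces the punctured limit in [derives_on] and treats endpoints and
    interior points alike. *)
Lemma derives_on_caratheodory (R : realType) (T : R) (f g : R -> R) (t : R) :
  derives_on T f g -> t \in `[0, T] ->
  exists q : R -> R, [/\ forall s, f s - f t = q s * (s - t),
    q t = g t & q @ within `[0, T] (nbhs t) --> g t].
Proof.
move=> fg tT; pose q s := if s == t then g t else (f s - f t) / (s - t).
exists q; split; last 2 first.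
- by rewrite /q eqxx.
- apply/cvgrPdist_le => e e0; rewrite near_withinE.
  have /cvgrPdist_le/(_ e e0) := fg t tT; rewrite !near_withinE => H.
  near=> s => sT; rewrite /q; case: eqVneq => [_|st]; first by rewrite subrr normr0 ltW.
  by move: sT st; near: s; move: H; apply: filterS => s /[swap] ? /[apply]; apply.
- move=> s; rewrite /q; case: eqVneq => [->|st]; first by rewrite !subrr mulr0.
  by rewrite divfK// subr_eq0.
Unshelve. all: by end_near. Qed.

Lemma derives_on_continuous (R : realType) (T : R) (f g : R -> R) :
  derives_on T f g -> {within `[0, T], continuous f}.
Proof.
move=> fg; apply/subspace_continuousP => t /= tT.
have [q [fq qt cq]] := derives_on_caratheodory fg tT.
have -> : f = (fun s => q s * (s - t) + f t).
  by apply/funext => s; rewrite -fq subrK.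
rewrite /= -[X in _ --> X]/(q t * (t - t) + f t) qt.
apply: cvgD; last exact: cvg_cst.
apply: cvgM => //; apply: cvgB; last exact: cvg_cst.
exact: cvg_within.
Qed.

Lemma derives_on_is_derive (R : realType) (T : R) (f g : R -> R) (t : R) :
  derives_on T f g -> t \in `]0, T[ -> is_derive t 1 f (g t).
Proof.
move=> fg tT; have tT' : t \in `[0, T] by exact: subset_itv_oo_cc.
have [q [fq qt cq]] := derives_on_caratheodory fg tT'.
apply/is_derive1_caratheodory; exists q; split=> //.
rewrite /prop_for /continuous_at qt.
apply/cvgrPdist_le => e e0; have /cvgrPdist_le/(_ e e0) := cq.
rewrite near_withinE => H; near=> s.
have : `[0, T]%classic s.
  apply: subset_itv_oo_cc; near: s; exact: near_in_itvoo.
by near: s; exact: H.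
Unshelve. all: by end_near. Qed.

(** Uniqueness by a Gronwall argument. It is used for [G = y V - 1], which vanishes exactly where
    [V] is the reciprocal of the solution [y]; there [M] bounds [k y]. *)
Lemma linear_ode_eq0 (R : realType) (T M : R) (a G : R -> R) :
  {within `[0, T], continuous G} ->
  (forall t : R, t \in `]0, T[ -> is_derive t 1 G (a t * G t)) ->
  (forall t : R, t \in `[0, T] -> a t <= M) -> G 0 = 0 ->
  forall t : R, t \in `[0, T] -> G t = 0.
Proof.
move=> cG dG aM G0 t tT.
have [t0 tT'] : 0 <= t /\ t <= T by move: tT; rewrite in_itv => /andP[].
(* [G ^ 2 exp (- 2 M t)] is non-negative, non-increasing and vanishes at 0. *)
pose E (s : R) : R := expR (- (2 * M) * s).
have dE (s : R) : is_derive s 1 E (- (2 * M) * E s).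
  have H : is_derive s (1 : R) (fun s : R => - (2 * M) * s) (- (2 * M)).
    by have := is_deriveM (is_derive_cst (- (2 * M)) s (1 : R)) (is_derive_id s (1 : R));
    move=> /is_derive_eq; apply; rewrite /GRing.scale/= !mulr1 mulr0 addr0.
  by have := is_derive1_comp (is_derive_expR _) H; move=> /is_derive_eq; apply; rewrite mulrC.
pose H := (fun s : R => G s * G s * E s).
have dH (s : R) : s \in `]0, T[ -> is_derive s 1 H (2 * (a s - M) * H s).
  move=> sT; have := is_deriveM (is_deriveM (dG s sT) (dG s sT)) (dE s).
  by move=> /is_derive_eq; apply; rewrite ?mulrfctE /GRing.scale/= /H/=; ring.
have cE : continuous E by move=> s; apply: differentiable_continuous; apply/derivable1_diffP; case: (dE s).
have cH : {within `[0, T], continuous H}.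
  apply/subspace_continuousP => s sT; rewrite /H.
  move/subspace_continuousP : cG => /(_ s sT) cG.
  apply: cvgM; first exact: cvgM.
  by apply: cvg_within_filter; exact: cE.
have H0 s : 0 <= H s by rewrite mulr_ge0 ?expR_ge0// -expr2 sqr_ge0.
suff : H t <= H 0.
  rewrite {2}/H G0 mul0r mul0r => Ht.
  have : H t == 0 by rewrite eq_le Ht H0.
  by rewrite !mulf_eq0 orbb (gt_eqF (expR_gt0 _)) orbF => /eqP.
have [->//|tn0] := eqVneq t 0.
have tgt0 : 0 < t by rewrite lt_neqAle eq_sym tn0.
have sub : {subset `]0, t[ <= `]0, T[}.
  by move=> s; rewrite !in_itv/= => /andP[-> /lt_le_trans]; apply.
have cHt : {within `[0, t], continuous H}.
  by apply: continuous_subspaceW cH => s /=; rewrite !in_itv/= => /andP[-> /le_trans]; apply.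
have [c ct] := MVT tgt0 (fun s st => dH s (sub _ st)) cHt.
have cT : c \in `[0, T] by apply: subset_itv_oo_cc; exact: sub.
rewrite subr0 -subr_le0 => ->; rewrite mulr_le0_ge0// mulr_le0_ge0//.
by rewrite mulr_ge0_le0// subr_le0 aM.
Qed.

(** * Integration against densities and products of independent variables *)

Section Density.
Import HBNNSimple.

(* Used with [phi = id], where [h] is the density of [nu] with respect to [mu],
   and with [phi] a random variable, where [h] is a product of functions of
   variables independent of [phi]. *)
Lemma integral_density d d' (T : measurableType d) (T' : measurableType d')
    (R : realType) (mu : {measure set T -> \bar R}) (nu : {measure set T' -> \bar R})
    (phi : T -> T') (h : T -> R) (f : T' -> R) :
  measurable_fun setT phi -> measurable_fun setT h -> (forall x, 0 <= h x) ->
  (forall A, measurable A -> nu A = \int[mu]_(x in phi @^-1` A) (h x)%:E)%E ->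
  measurable_fun setT f -> (forall x, 0 <= f x) ->
  (\int[nu]_x (f x)%:E = \int[mu]_x (f (phi x) * h x)%:E)%E.
Proof.
move=> mphi mh h0 nuE mf f0.
have mE : measurable [set: T'] by [].
have mfE : measurable_fun [set: T'] (EFin \o f) by exact/measurable_EFinP.
pose k := nnsfun_approx mE mfE.
have kf x : (EFin \o k ^~ x) n @[n --> \oo] --> (f x)%:E.
  by apply: cvg_nnsfun_approx => // y _; rewrite lee_fin.
have mkphi n : measurable_fun setT (fun x => (k n (phi x) * h x)%:E).
  apply/measurable_EFinP/measurable_funM => //.
  by apply: measurableT_comp => //; exact/measurable_funP.
(* Monotone convergence on both sides reduces the claim to the simple functions [k n]. *)
have -> : (\int[nu]_x (f x)%:E = lim (\int[nu]_x (k n x)%:E @[n --> \oo]))%E.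
  under eq_integral => x _ do rewrite -(cvg_lim _ (kf x))//.
  apply: monotone_convergence => //.
  - by move=> n; apply/measurable_EFinP; exact/measurable_funP.
  - by move=> n x _ /=; rewrite lee_fin.
  - by move=> x _ a b ab; rewrite lee_fin; exact/lefP/nd_nnsfun_approx.
have -> : (\int[mu]_x (f (phi x) * h x)%:E =
    lim (\int[mu]_x (k n (phi x) * h x)%:E @[n --> \oo]))%E.
  have fh x : (k n (phi x) * h x)%:E @[n --> \oo] --> (f (phi x) * h x)%:E.
    under eq_fun do rewrite EFinM.
    by rewrite EFinM; apply: cvgeZr => //; exact: kf.
  under eq_integral => x _ do rewrite -(cvg_lim _ (fh x))//.
  apply: monotone_convergence => //.
  - by move=> n x _ /=; rewrite lee_fin mulr_ge0.
  - move=> x _ a b ab; rewrite lee_fin ler_wpM2r//.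
    exact/lefP/nd_nnsfun_approx.
(* A simple function is a combination of indicators of its level sets, and on each of these the
   claim is [nuE]. *)
suff E n : (\int[nu]_x (k n x)%:E = \int[mu]_x (k n (phi x) * h x)%:E)%E.
  by under eq_fun do rewrite E.
have mpre y : measurable (k n @^-1` [set y]) by [].
have mpre' y : measurable (phi @^-1` (k n @^-1` [set y])).
  by rewrite -[X in measurable X]setTI; exact: mphi.
transitivity (\int[nu]_x
   (\sum_(y \in range (k n)) (y * \1_(k n @^-1` [set y]) x)%:E))%E.
  by apply: eq_integral => t _; rewrite fimfunE -fsumEFin.
rewrite ge0_integral_fsum//; last 2 first.
  - by move=> y; apply/measurable_EFinP; exact: measurable_funM.
  - by move=> y x _; exact: nnfun_muleindic_ge0.
transitivity (\int[mu]_x (\sum_(y \in range (k n))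
    (y * \1_(k n @^-1` [set y]) (phi x))%:E * (h x)%:E))%E; last first.
  apply: eq_integral => x _.
  rewrite -ge0_mule_fsuml; last by move=> y; exact: nnfun_muleindic_ge0.
  by rewrite fsumEFin// -fimfunE.
rewrite ge0_integral_fsum//; last 2 first.
  - move=> y; apply: emeasurable_funM; apply/measurable_EFinP => //.
    by apply: measurable_funM => //; exact: measurableT_comp.
  - by move=> y x _; apply: mule_ge0; [exact: nnfun_muleindic_ge0|rewrite lee_fin].
apply: eq_fsbigr => y; rewrite inE => -[z _ <-].
have kz : 0 <= k n z by [].
under eq_integral do rewrite EFinM.
under [RHS]eq_integral do rewrite EFinM -muleA.
have m1 : measurable_fun [set: T] (fun x => \1_(k n @^-1` [set k n z]) (phi x) : R).
  by apply: measurableT_comp => //; exact: measurable_indic.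
rewrite [LHS]ge0_integralZl_EFin//; last exact/measurable_EFinP/measurable_indic.
rewrite [RHS]ge0_integralZl_EFin//; last 2 first.
  - by move=> x _; rewrite mule_ge0 ?lee_fin.
  - by apply: emeasurable_funM; apply/measurable_EFinP.
rewrite integral_indic// setIT nuE// integral_mkcond epatch_indic; congr (_ * _)%E.
by apply: eq_integral => x _; rewrite muleC.
Qed.

End Density.

Lemma prod_indic_bigcap (R : realType) (T : Type) (s : seq nat) (A : nat -> set T) (w : T) :
  \prod_(k <- s) (\1_(A k) w : R) = \1_(\bigcap_(k in [set` s]) A k) w.
Proof.
elim: s => [|k s IH]; first by rewrite big_nil bigcap_seq big_nil indicT.
by rewrite big_cons IH !bigcap_seq big_cons indicI.
Qed.

(* Independence is the case [s1 = [::]]; by induction the indicators are replaced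
   with general functions one at a time. *)
Lemma integral_prod_indep d (T : measurableType d) (R : realType)
    (P : probability T R) (D : set nat) (X : nat -> {RV P >-> R})
    (f : nat -> R -> R) (m : nat -> R) (s1 s2 : seq nat) (B : nat -> set R) :
  mutually_independent D X ->
  (forall k, measurable_fun setT (f k)) -> (forall k x, 0 <= f k x) ->
  (forall k, k \in s1 -> \int[P]_w (f k (X k w))%:E = (m k)%:E)%E ->
  uniq (s1 ++ s2) -> (forall k, k \in s1 ++ s2 -> D k) ->
  (forall k, measurable (B k)) ->
  (\int[P]_w (\prod_(k <- s1) f k (X k w) * \prod_(k <- s2) \1_(B k) (X k w))%:E =
   (\prod_(k <- s1) m k * \prod_(k <- s2) fine (P (X k @^-1` B k)))%:E)%E.
Proof.
move=> indX mf f0; elim: s1 s2 B => [|k s IH] s2 B mE us Ds mB.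
  rewrite !big_nil mul1r.
  under eq_integral do rewrite big_nil mul1r (prod_indic_bigcap _ _ (fun k => X k @^-1` B k)).
  have mXB j : measurable (X j @^-1` B j).
    by rewrite -[X in measurable X]setTI; exact: measurable_funP.
  rewrite integral_indic//; last by rewrite bigcap_seq; exact: bigsetI_measurable.
  rewrite setIT; transitivity (\prod_(k <- s2) P (X k @^-1` B k))%E; first exact: indX.
  rewrite -prodEFin; apply: eq_bigr => j _.
  by rewrite fineK// fin_num_measure.
have mk0 j : j \in k :: s -> 0 <= m j.
  by move=> js; rewrite -lee_fin -mE// integral_ge0// => w _; rewrite lee_fin.
(* [c] is the value which the induction hypothesis gives for the expectation of [h], the product of
   all factors other than the one of index [k]. So [h] should be the density, along [X k], of [c]
   times the law of [X k]. *)
pose c := \prod_(j <- s) m j * \prod_(j <- s2) fine (P (X j @^-1` B j)).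
have c0 : 0 <= c.
  apply: mulr_ge0; last by apply: prodr_ge0 => j _; exact: fine_ge0.
  by rewrite big_seq; apply: prodr_ge0 => j js; apply: mk0; rewrite in_cons js orbT.
pose h w := \prod_(j <- s) f j (X j w) * \prod_(j <- s2) \1_(B j) (X j w).
have h0 w : 0 <= h w by rewrite mulr_ge0 ?prodr_ge0.
have mh : measurable_fun setT h.
  apply: measurable_funM; apply: measurable_prod => j _.
    by apply: measurableT_comp => //; exact: measurable_funP.
  by apply: (measurableT_comp (measurable_indic (mB j))); exact: measurable_funP.
have := @integral_density _ _ _ _ R P
  (mscale (NngNum c0) (distribution P (X k))) (X k) h (f k) _ mh h0 _ (mf k) (f0 k).
move=> /(_ (measurable_funP (X k))) dens.
under eq_integral do rewrite big_cons -mulrA -/(h _).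
rewrite -dens.
  rewrite ge0_integral_mscale; [|by []|exact/measurable_EFinP|by move=> x _; rewrite lee_fin].
  rewrite ge0_integral_distribution; [|exact/measurable_EFinP|by move=> x; rewrite lee_fin].
  by rewrite /= mE ?mem_head// big_cons -EFinM mulrC mulrA.
move=> A mA; rewrite integral_mkcond epatch_indic /mscale/=.
(* Inserting [A] at index [k] turns the density identity into the induction hypothesis for
   [k :: s2]: the event that [X k] lies in [A] is one more indicator factor. *)
pose B' j := if j == k then A else B j.
have kns : k \notin s ++ s2 by move: us => /= /andP[].
have B'E j : j \in s2 -> B' j = B j.
  by move=> js; rewrite /B' ifN//; apply: contraNneq kns => <-; rewrite mem_cat js orbT.
have B'k : B' k = A by rewrite /B' eqxx.
have := IH (k :: s2) B'; rewrite !big_cons.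
under eq_integral do rewrite big_cons (eq_big_seq _ (fun j js => congr1 (fun C => \1_C (X j _)) (B'E j js))) B'k mulrCA -/(h _).
rewrite (eq_big_seq _ (fun j js => congr1 (fun C => fine (P (X j @^-1` C))) (B'E j js))) B'k.
rewrite mulrCA -/c => IHk.
transitivity ((fine (P (X k @^-1` A)) * c)%:E).
  rewrite EFinM fineK ?fin_num_measure//; first by rewrite muleC.
  by rewrite -[X in measurable X]setTI; exact: measurable_funP.
rewrite -IHk.
- by apply: eq_integral => w _; rewrite /= -EFinM mulrC.
- by move=> j js; apply: mE; rewrite in_cons js orbT.
- by rewrite (perm_uniq (permEl (perm_catCA s [:: k] s2))).
- by move=> j js; apply: Ds; rewrite -(perm_mem (permEl (perm_catCA s [:: k] s2))).
- by move=> j; rewrite /B'; case: ifP.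
Qed.

(** * Exponential moments of Gaussian combinations *)

Lemma integral_expR_normal d (T : measurableType d) (R : realType)
    (P : probability T R) (X : {RV P >-> R}) (s a : R) : s != 0 ->
  (forall A : set R, measurable A -> distribution P X A = normal_prob 0 s A) ->
  (\int[P]_w (expR (a * X w))%:E = (expR (a ^+ 2 * s ^+ 2 / 2))%:E)%E.
Proof.
move=> s0 gX.
have mexp : measurable_fun setT (fun x : R => expR (a * x)).
  by apply: measurableT_comp => //; exact: measurable_funM.
transitivity (\int[distribution P X]_x (expR (a * x))%:E)%E.
  rewrite ge0_integral_distribution; [by []|exact/measurable_EFinP|].
  by move=> x; rewrite lee_fin expR_ge0.
have -> := @integral_density _ _ _ _ R lebesgue_measure (distribution P X) id
  (normal_pdf 0 s) (fun x => expR (a * x)) (@measurable_id _ _ _)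
  (measurable_normal_pdf 0 s) (normal_pdf_ge0 0 s) gX mexp
  (fun x => expR_ge0 (a * x)).
(* Completing the square. *)
transitivity (\int[lebesgue_measure]_x
   ((expR (a ^+ 2 * s ^+ 2 / 2))%:E * (normal_pdf (a * s ^+ 2) s x)%:E))%E.
  apply: eq_integral => x _; rewrite -EFinM; congr EFin.
  rewrite !normal_pdfE// mulrCA [RHS]mulrCA; congr (_ * _).
  rewrite -!expRD; congr expR; rewrite subr0 mulr2n.
  by field; rewrite -mulr2n mulrn_eq0/= expf_eq0/= s0.
have mpdf : measurable_fun setT (fun x => (normal_pdf (a * s ^+ 2) s x)%:E).
  by apply/measurable_EFinP; exact: measurable_normal_pdf.
have pdf0 (x : R) : setT x -> (0 <= (normal_pdf (a * s ^+ 2) s x)%:E)%E.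
  by move=> _; rewrite lee_fin normal_pdf_ge0.
have -> := @ge0_integralZl_EFin _ _ R lebesgue_measure setT measurableT
  (fun x => (normal_pdf (a * s ^+ 2) s x)%:E) pdf0 mpdf _ (expR_ge0 _).
by rewrite integral_normal_pdf mule1.
Qed.

(** The exponential of the sum is a product of functions of independent variables, so
    [integral_prod_indep] without indicator factors reduces it to single Gaussians. *)
Lemma integral_expR_sum d (T : measurableType d) (R : realType)
    (P : probability T R) (D : set nat) (X : nat -> {RV P >-> R})
    (s : nat -> R) (a : nat -> R) (I : seq nat) :
  mutually_independent D X ->
  (forall k, D k -> s k != 0) ->
  (forall k, D k -> forall A : set R, measurable A ->
     distribution P (X k) A = normal_prob 0 (s k) A) ->
  uniq I -> (forall k, k \in I -> D k) ->
  (\int[P]_w (expR (\sum_(k <- I) a k * X k w))%:E =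
   (expR (\sum_(k <- I) a k ^+ 2 * s k ^+ 2 / 2))%:E)%E.
Proof.
move=> indX s0 gX uI DI.
have mf k : measurable_fun setT (fun x : R => expR (a k * x)).
  by apply: measurableT_comp => //; exact: measurable_funM.
rewrite expR_sum.
have := @integral_prod_indep _ _ _ P D X (fun k x => expR (a k * x))
  (fun k => expR (a k ^+ 2 * s k ^+ 2 / 2)) I [::] (fun=> setT) indX mf.
under eq_integral do rewrite big_nil mulr1 -expR_sum.
rewrite big_nil mulr1; apply => //.
- by move=> k kI; apply: integral_expR_normal; [exact/s0/DI|exact/gX/DI].
- by rewrite cats0.
- by move=> k; rewrite cats0; exact: DI.
Qed.

(** * The second Borel-Cantelli lemma *)

(** By independence and [1 - q <= exp (- q)], the probability that none of the events of index [m]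
    to [n - 1] occurs is at most the exponential of minus the sum of the [q k], which divergence
    makes arbitrarily small. *)
Lemma borel_cantelli_indep d (T : measurableType d) (R : realType)
    (P : probability T R) (k0 : nat) (X : nat -> {RV P >-> R})
    (B : nat -> set R) (q : nat -> R) :
  mutually_independent [set k | (k0 <= k)%N] X ->
  (forall k, measurable (B k)) ->
  (forall k, (k0 <= k)%N -> (q k)%:E <= P (X k @^-1` B k))%E ->
  (forall m M, (k0 <= m)%N -> exists n, M <= \sum_(m <= k < n) q k) ->
  {ae P, forall w, forall m, exists2 k, (m <= k)%N & B k (X k w)}.
Proof.
move=> indX mB Pq divq.
have mXB k A : measurable A -> measurable (X k @^-1` A).
  by move=> mA; rewrite -[X in measurable X]setTI; exact: measurable_funP.
pose N m := \bigcap_(k in [set k | (m <= k)%N]) X k @^-1` (~` B k).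
have mN m : measurable (N m).
  by apply: bigcap_measurableType => k _; apply: mXB; exact: measurableC.
have N0 m : (k0 <= m)%N -> P (N m) = 0%E.
  move=> k0m; apply/eqP; rewrite eq_le measure_ge0 andbT.
  apply/lee_addgt0Pr => e e0; rewrite add0e.
  have [n Mn] := divq m (- ln e) k0m.
  apply: (@le_trans _ _ (P (\bigcap_(k in [set` index_iota m n]) X k @^-1` (~` B k)))).
    apply: le_measure; rewrite ?inE//.
      by apply: bigcap_measurableType => k _; apply: mXB; exact: measurableC.
    by move=> w Nw k /=; rewrite mem_index_iota => /andP[mk _]; exact: Nw.
  rewrite indX ?iota_uniq//; last 2 first.
    by move=> k; rewrite mem_index_iota => /andP[mk _]; exact: leq_trans mk.
    by move=> k; exact: measurableC.
  have PC k : (m <= k)%N -> (P (X k @^-1` (~` B k)) <= (expR (- q k))%:E)%E.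
    move=> mk; rewrite preimage_setC probability_setC; last exact: mXB.
    have : (1 - P (X k @^-1` B k) <= 1 - (q k)%:E)%E.
      by apply: leeB => //; apply: Pq; exact: leq_trans mk.
    by move/le_trans; apply; rewrite -EFinB lee_fin; exact: expR_ge1Dx.
  have finP k : P (X k @^-1` (~` B k)) \is a fin_num.
    by apply: fin_num_measure; apply: mXB; exact: measurableC.
  rewrite (eq_bigr (fun k => (fine (P (X k @^-1` (~` B k))))%:E)); last first.
    by move=> k _; rewrite fineK.
  rewrite prodEFin lee_fin.
  apply: (@le_trans _ _ (\prod_(m <= k < n) expR (- q k))).
    rewrite big_seq [leRHS]big_seq; apply: ler_prod => k.
    rewrite mem_index_iota => /andP[mk _].
    by rewrite fine_ge0//= -lee_fin fineK// PC.
  by rewrite -expR_sum sumrN -[leRHS]lnK// ler_expR lerNl.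
(* The shift by [k0] keeps all indices in the range where independence is assumed. *)
have : P.-negligible (\bigcup_m N (m + k0)%N).
  by apply: negligible_bigcup => m; apply/negligibleP => //; exact: N0 (leq_addl _ _).
apply: negligibleS => w /= /existsNP[m Hm]; exists m => // k mk Bk.
by apply: Hm; exists k => //; apply: leq_trans mk; rewrite leq_addr.
Qed.

(** * Gaussian tails and a divergent series *)

Lemma normal_prob_tail (R : realType) (s y : R) : 0 < s -> 1 <= y ->
  ((expR (- (3 / 2)) / Num.sqrt (pi *+ 2) * (expR (- (y ^+ 2 / 2)) / y))%:E
    <= normal_prob 0 s `[(s * y)%R, +oo[%classic)%E.
Proof.
move=> s0 y1; have y0 : 0 < y by exact: lt_le_trans y1.
(* The density is at least [c] on [J], an interval of length [s / y]. *)
pose J := `[s * y, s * (y + y^-1)]%classic.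
have mpdf : measurable_fun setT (fun x => (normal_pdf 0 s x)%:E).
  by apply/measurable_EFinP; exact: measurable_normal_pdf.
apply: (@le_trans _ _ (normal_prob 0 s J)); last first.
  apply: ge0_subset_integral => //.
  - exact: measurable_itv.
  - exact: measurable_funTS.
  - by move=> x _; rewrite lee_fin normal_pdf_ge0.
  - by move=> x /=; rewrite !in_itv/= andbT => /andP[].
pose c := expR (- (3 / 2)) / Num.sqrt (pi *+ 2) * expR (- (y ^+ 2 / 2)) / s.
have c0 : 0 <= c.
  apply: divr_ge0; last exact: ltW.
  by rewrite mulr_ge0 ?expR_ge0// divr_ge0 ?expR_ge0// sqrtr_ge0.
apply: (@le_trans _ _ (\int[lebesgue_measure]_(x in J) (cst c%:E) x)%E).
  have lJ : (lebesgue_measure J = (s / y)%:E)%E.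
    rewrite /J lebesgue_measure_itv/= lte_fin ifT; last first.
      by rewrite ltr_pM2l// ltrDl invr_gt0.
    by rewrite -EFinD mulrDr addrAC subrr add0r.
  have -> : (\int[lebesgue_measure]_(x in J) (cst c%:E) x = c%:E * (s / y)%:E)%E.
    by rewrite -lJ; apply: integral_cst; exact: measurable_itv.
  rewrite -EFinM lee_fin /c.
  rewrite le_eqVlt; apply/orP; left; apply/eqP.
  by field; rewrite !gt_eqF//= sqrtr_gt0 pmulrn_lgt0 ?pi_gt0.
apply: ge0_le_integral => //.
- exact: measurable_itv.
- exact: measurable_funTS.
move=> x; rewrite /J/= in_itv/= => /andP[x1 x2].
rewrite lee_fin normal_pdfE ?gt_eqF// /normal_peak /normal_fun subr0.
have -> : Num.sqrt (s ^+ 2 * pi *+ 2) = s * Num.sqrt (pi *+ 2).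
  by rewrite -mulrnAr sqrtrM ?sqr_ge0// sqrtr_sqr gtr0_norm.
have q0 : 0 < Num.sqrt (pi *+ 2 : R) by rewrite sqrtr_gt0 pmulrn_lgt0 ?pi_gt0.
have -> : c = (s * Num.sqrt (pi *+ 2))^-1 * expR (- (3 / 2) - y ^+ 2 / 2).
  by rewrite /c expRD; field; rewrite !gt_eqF.
rewrite ler_pM2l ?invr_gt0 ?mulr_gt0// ler_expR.
have x0 : 0 <= x by apply: le_trans x1; rewrite mulr_ge0// ltW.
(* The square of [y + 1 / y] is [y ^ 2 + 2 + y ^ -2], at most [y ^ 2 + 3] as [y >= 1]. This is the
   origin of the factor [exp (- 3 / 2)]. *)
have : x ^+ 2 <= s ^+ 2 * (y ^+ 2 + 3).
  apply: (@le_trans _ _ ((s * (y + y^-1)) ^+ 2)).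
    by rewrite ler_pXn2r// nnegrE// mulr_ge0 ?addr_ge0 ?invr_ge0 ?ltW.
  rewrite exprMn ler_pM2l ?exprn_gt0// sqrrD mulfV ?gt_eqF// -addrA lerD2l.
  have : (y ^+ 2)^-1 <= 1 by rewrite invf_le1 ?exprn_gt0// exprn_ege1.
  by rewrite exprVn mulr2n; lra.
rewrite -ler_pdivrMl ?exprn_gt0// => h.
have -> : - x ^+ 2 / (s ^+ 2 *+ 2) = - ((s ^+ 2)^-1 * x ^+ 2 / 2).
  by rewrite -mulr_natr; field; rewrite gt_eqF.
lra.
Qed.

(** Comparison with the primitive [ln (ln x)] of [1 / (x ln x)], one increment at a time; it is
    unbounded, so the series diverges. *)
Lemma sum_inv_nlnn_ge (R : realType) (m n : nat) : (2 <= m <= n)%N ->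
  ln (ln n%:R) - ln (ln m%:R) <= \sum_(m <= k < n) (k%:R * ln k%:R)^-1 :> R.
Proof.
move=> /andP[m2]; elim: n => [|n IH]; first by rewrite leqn0 => /eqP m0; rewrite m0 in m2.
rewrite leq_eqVlt => /predU1P[->|]; last rewrite ltnS => mn; first by rewrite subrr big_geq.
rewrite big_nat_recr//=; apply: (@le_trans _ _ (ln (ln n%:R) - ln (ln m%:R) + (n%:R * ln n%:R)^-1)); last first.
  by rewrite lerD2r IH.
rewrite addrAC lerD2r -lerBlDl.
have n1 : (1 < n)%N by exact: leq_trans m2 mn.
have n0 : 0 < n%:R :> R by rewrite ltr0n ltnW.
have ln0 : 0 < ln n%:R :> R by rewrite ln_gt0 ?ltr1n.
have ln1 : 0 < ln n.+1%:R :> R by rewrite ln_gt0 ?ltr1n// ltnW.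
(* [ln (1 + x) <= x], applied to [ln] and then to its argument. *)
have h (a b : R) : 0 < a -> 0 < b -> ln b - ln a <= (b - a) / a.
  move=> a0 b0; rewrite -ln_div ?posrE//.
  have -> : b / a = 1 + (b - a) / a by rewrite mulrBl divff ?gt_eqF// addrC subrK.
  apply: le_ln1Dx; rewrite mulrBl divff ?gt_eqF//.
  by rewrite -[ltLHS]add0r ltrD2r divr_gt0.
apply: (le_trans (h _ _ ln0 ln1)); rewrite invfM ler_pM2r ?invr_gt0//.
apply: (le_trans (h _ _ n0 _)); first by rewrite ltr0n.
by rewrite -natrB// subSnn mul1r.
Qed.

Lemma ln2_ge (R : realType) (k : nat) : (2 <= k)%N -> 1 <= 2 * ln (k%:R : R).
Proof.
move=> k2; have k0 : (0 : R) < k%:R by rewrite ltr0n ltnW.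
suff : 2^-1 <= ln (2 : R).
  move=> h; have : ln (2 : R) <= ln k%:R by rewrite ler_ln ?posrE// ler_nat.
  by lra.
rewrite -[leLHS]opprK lerNl -lnV ?posrE//.
rewrite -ler_expR lnK ?posrE ?invr_gt0//.
by apply: le_trans (expR_ge1Dx _); lra.
Qed.

(** * Blow-up of a single mode *)

Lemma blowup_time_ge0 (R : realType) (k : nat) (x : R) : (0 <= blowup_time k x)%E.
Proof.
rewrite /blowup_time; case: ifPn => // /norP[_]; rewrite -leNgt lee_fin => //.
Qed.

(** Solving [- k ^ -2 ln (1 - k / x) <= e] for [x] gives this threshold; [sigma] is the threshold
    for [e = eps k] divided by [sqrt (2 log k)]. *)
Lemma blowup_time_le (R : realType) (k : nat) (x e : R) : (0 < k)%N -> 0 < e ->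
  k%:R / (1 - expR (- (k%:R ^+ 2 * e))) <= x -> (blowup_time k x <= e%:E)%E.
Proof.
move=> k0 e0 kx.
have kR : 0 < k%:R :> R by rewrite ltr0n.
have ke : 0 < k%:R ^+ 2 * e by rewrite mulr_gt0// exprn_gt0.
have E0 : 0 < 1 - expR (- (k%:R ^+ 2 * e)) by rewrite subr_gt0 expR_lt1 oppr_lt0.
have x0 : 0 < x by apply: lt_le_trans kx; rewrite divr_gt0.
have kxE : k%:R ^+ 2 / (k%:R * x) = k%:R / x by field; rewrite !gt_eqF.
have aE : expR (- (k%:R ^+ 2 * e)) <= 1 - k%:R / x.
  by rewrite lerBrDl -lerBrDr ler_pdivrMr// -ler_pdivrMl// mulrC.
have a0 : 0 < 1 - k%:R / x by apply: lt_le_trans aE; exact: expR_gt0.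
(* The three cases in which [blowup_time] is [+oo] are excluded in turn. *)
rewrite /blowup_time kxE gt_eqF ?mulr_gt0//= [_ <= 0]leNgt a0/= ltNge.
have -> : 0 <= - (k%:R ^+ 2)^-1 * ln (1 - k%:R / x).
  rewrite mulNr oppr_ge0 pmulr_rle0 ?invr_gt0 ?exprn_gt0//.
  by apply: ln_le0; rewrite gerBl divr_ge0// ltW.
rewrite /= lee_fin mulNr lerNl ler_pdivlMl ?exprn_gt0// mulrN.
by rewrite -ler_expR lnK ?posrE.
Qed.

Lemma blowup_no_solution (R : realType) (k : nat) (x T : R) (y : R -> R) :
  (0 < k)%N -> (blowup_time k x <= T%:E)%E -> y 0 = x ->
  ~ derives_on T y (fun t => - k%:R ^+ 2 * y t + k%:R * y t ^+ 2).
Proof.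
move=> k0 bT y0 dy.
have kR : 0 < k%:R :> R by rewrite ltr0n.
move: bT; rewrite /blowup_time; case: ifPn => // /norP[/norP[kx0]].
rewrite -ltNge -leNgt lee_fin => a0 t0 tT.
have x0 : x != 0 by move: kx0; rewrite mulf_eq0 => /norP[].
have kxE : k%:R ^+ 2 / (k%:R * x) = k%:R / x by field; rewrite x0 gt_eqF.
rewrite kxE in a0 t0 tT; set t1 := - _ * _ in t0 tT.
(* [V] solves the linear equation of [1 / y], so that [y V = 1] as long as [y]
   exists; but [V] vanishes at the blow-up time [t1]. *)
pose V (t : R) : R := k%:R^-1 + (x^-1 - k%:R^-1) * expR (k%:R ^+ 2 * t).
have dV (t : R) : is_derive t (1 : R) V (k%:R ^+ 2 * V t - k%:R).
  have H : is_derive t (1 : R) (fun s : R => k%:R ^+ 2 * s) (k%:R ^+ 2).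
    have := is_deriveM (is_derive_cst (k%:R ^+ 2 : R) t (1 : R)) (is_derive_id t (1 : R)).
    by move=> /is_derive_eq; apply; rewrite /GRing.scale/= !mulr1 mulr0 addr0.
  have H2 := is_derive1_comp (is_derive_expR _) H.
  have H3 := is_deriveM (is_derive_cst (x^-1 - k%:R^-1 : R) t (1 : R)) H2.
  have H4 := is_deriveD (is_derive_cst (k%:R^-1 : R) t (1 : R)) H3.
  apply: (is_derive_eq H4); rewrite /GRing.scale/= /V.
  by field; rewrite x0 gt_eqF.
have cV : continuous V.
  by move=> t; apply: differentiable_continuous; apply/derivable1_diffP; case: (dV t).
have cy := derives_on_continuous dy.
(* [y] is continuous on the compact interval [[0, T]], so the coefficient [k y] in the equation for
   [G] is bounded. *)
have [M My] : exists M, forall t, t \in `[0, T] -> k%:R * y t <= M.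
  have [c _ cmax] := EVT_max (le_trans t0 tT) cy.
  by exists (k%:R * y c) => t tT'; rewrite ler_pM2l// cmax.
pose G (t : R) := y t * V t - 1.
have G0 : forall t : R, t \in `[0, T] -> G t = 0.
  apply: (@linear_ode_eq0 _ _ M (fun t => k%:R * y t) G _ _ My).
  - apply/subspace_continuousP => s sT; rewrite /G.
    move/subspace_continuousP : cy => /(_ s sT) cy.
    apply: cvgB; last exact: cvg_cst.
    by apply: cvgM => //; apply: cvg_within_filter; exact: cV.
  (* In [y' V + y V'] the terms in [k ^ 2] cancel, which leaves [G' = k y (y V - 1) = k y G]. *)
  - move=> t /(derives_on_is_derive dy) dyt.
    have H := is_deriveB (is_deriveM dyt (dV t)) (is_derive_cst (1 : R) t (1 : R)).
    by apply: (is_derive_eq H); rewrite /GRing.scale/= /G/=; ring.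
  - by rewrite /G /V y0 mulr0 expR0 mulr1 addrCA subrr addr0 divff// subrr.
have := G0 t1; rewrite in_itv/= t0 tT => /(_ isT); rewrite /G.
(* Here [exp (k ^ 2 t1)] is the inverse of [1 - k / x], and [1 / x - 1 / k] is [- (1 - k / x) / k].
   Hence [G t1 = -1], a contradiction. *)
have -> : V t1 = 0.
  rewrite /V /t1 mulrA mulrN divff ?expf_neq0 ?gt_eqF// mulN1r expRN lnK//.
  field; rewrite x0 [k%:R == 0]gt_eqF// andbT/= subr_eq0.
  by apply: contraTneq a0 => ->; rewrite divff ?subrr ?ltxx// gt_eqF.
by rewrite mulr0 sub0r => /eqP; rewrite oppr_eq0 oner_eq0.
Qed.

(** * Infinitely many early blow-ups and their consequences *)

Lemma one_sub_expRN_gt0 (R : realType) (k : nat) (e : R) : (0 < k)%N -> 0 < e ->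
  0 < 1 - expR (- (k%:R ^+ 2 * e)).
Proof.
by move=> k0 e0; rewrite subr_gt0 expR_lt1 oppr_lt0 mulr_gt0// exprn_gt0// ltr0n.
Qed.

Lemma sigma_gt0 (R : realType) (eps : nat -> R) (k : nat) :
  (2 <= k)%N -> 0 < eps k -> 0 < sigma eps k.
Proof.
move=> k2 e0; have k0 : (0 < k)%N by exact: ltnW.
rewrite /sigma divr_gt0 ?ltr0n// mulr_gt0 ?one_sub_expRN_gt0// sqrtr_gt0.
by rewrite (lt_le_trans _ (ln2_ge R k2)).
Qed.

Lemma ae_frequently_blowup d (T : measurableType d) (R : realType)
    (P : probability T R) (eps : nat -> R) (X : nat -> {RV P >-> R}) :
  (forall k, (2 <= k)%N -> 0 < eps k) ->
  (forall k, (2 <= k)%N -> forall A : set R, measurable A ->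
     distribution P (X k) A = normal_prob 0 (sigma eps k) A) ->
  mutually_independent [set k | (2 <= k)%N] X ->
  {ae P, forall w, forall m, exists2 k, (m <= k)%N &
     (2 <= k)%N /\ (blowup_time k (X k w) <= (eps k)%:E)%E}.
Proof.
move=> eps0 gX indX.
(* [blowup_time k x <= eps k] as soon as [x >= sigma eps k * y k]. *)
pose y k : R := Num.sqrt (2 * ln k%:R).
pose B k := `[sigma eps k * y k, +oo[%classic.
(* The constant of the tail bound, halved: since [y k >= 1], [1 / y k] is at least
   [1 / y k ^ 2 = 1 / (2 ln k)]. *)
pose c : R := expR (- (3 / 2)) / Num.sqrt (pi *+ 2) / 2.
have c0 : 0 < c by rewrite !divr_gt0 ?expR_gt0// sqrtr_gt0 pmulrn_lgt0 ?pi_gt0.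
have PB k : (2 <= k)%N -> ((c * (k%:R * ln k%:R)^-1)%:E <= P (X k @^-1` B k))%E.
  move=> k2; have ln2 := ln2_ge R k2.
  have kR : 0 < k%:R :> R by rewrite ltr0n ltnW.
  have l0 : 0 < 2 * ln (k%:R : R) by exact: lt_le_trans ln2.
  have y1 : 1 <= y k by rewrite /y -[leLHS]sqrtr1 ler_wsqrtr.
  have y2 : y k ^+ 2 = 2 * ln k%:R by rewrite sqr_sqrtr// ltW.
  have := gX k k2 (B k) (measurable_itv _); rewrite /distribution/pushforward => ->.
  apply: le_trans (normal_prob_tail (sigma_gt0 k2 (eps0 k k2)) y1) => //.
  rewrite lee_fin y2 (_ : 2 * ln k%:R / 2 = ln k%:R); last by field.
  rewrite expRN lnK ?posrE//.
  rewrite /c -mulrA ler_pM2l; last first.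
    by rewrite divr_gt0 ?expR_gt0// sqrtr_gt0 pmulrn_lgt0 ?pi_gt0.
  rewrite invfM mulrCA ler_pM2l ?invr_gt0// -invfM lef_pV2 ?posrE//; last first.
    by exact: lt_le_trans y1.
  by rewrite -y2 expr2 ler_peMl// (le_trans _ y1).
have div m M : (2 <= m)%N -> exists n, M <= \sum_(m <= k < n) c * (k%:R * ln k%:R)^-1.
  (* [L] is the point where [ln (ln n) - ln (ln m)] reaches [M / c]. *)
  move=> m2; pose L := expR (expR (M / c + ln (ln m%:R))).
  have [n [mn Ln]] : exists n, (m <= n)%N /\ L <= n%:R.
    exists (maxn m (Num.truncn L).+1); split; first exact: leq_maxl.
    apply: (@le_trans _ _ (Num.truncn L).+1%:R); last by rewrite ler_nat leq_maxr.
    by apply/ltW/truncnS_gt.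
  exists n; rewrite -mulr_sumr mulrC -ler_pdivrMr//.
  apply: le_trans (sum_inv_nlnn_ge _ _); last by rewrite m2.
  rewrite lerBrDr -[leLHS]expRK ler_ln ?posrE ?expR_gt0//; last first.
    by rewrite ln_gt0// ltr1n (leq_trans m2).
  by rewrite -[leLHS]expRK ler_ln ?posrE ?expR_gt0// ltr0n (leq_trans _ mn)// ltnW.
have := borel_cantelli_indep indX (fun k => measurable_itv _) PB div.
apply: filterS => w /= H m; have [k mk Bk] := H (maxn m 2).
exists k; first by apply: leq_trans mk; exact: leq_maxl.
have k2 : (2 <= k)%N by apply: leq_trans mk; exact: leq_maxr.
split=> //; apply: blowup_time_le; [exact: ltnW|exact: eps0|].
move: Bk; rewrite /B /= in_itv/= andbT; apply: le_trans.
rewrite /sigma -/(y k) le_eqVlt; apply/orP; left; apply/eqP.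
have y0 : y k != 0 by rewrite gt_eqF// sqrtr_gt0 (lt_le_trans _ (ln2_ge R k2)).
by field; rewrite y0 gt_eqF// one_sub_expRN_gt0 ?eps0// ltnW.
Qed.

Lemma infinite_set_frequently (A : set nat) :
  (forall m, exists2 k, (m <= k)%N & A k) -> infinite_set A.
Proof.
move=> H /finite_seqP[s sE]; have [k mk] := H (\max_(j <- s) j).+1.
rewrite sE /= => ks; move: mk.
by rewrite ltnNge; apply/negP; rewrite negbK; exact: leq_bigmax_seq.
Qed.

Lemma ereal_inf_blowup_time (R : realType) (eps x : nat -> R) :
  eps @ \oo --> (0 : R) ->
  (forall m, exists2 k, (m <= k)%N &
     (2 <= k)%N /\ (blowup_time k (x k) <= (eps k)%:E)%E) ->
  ereal_inf [set blowup_time k (x k) | k in [set k | (1 <= k)%N]] = 0%E.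
Proof.
move=> eps0 H; apply/eqP; rewrite eq_le; apply/andP; split; last first.
  by apply: le_ereal_inf_tmp => _ [k _ <-]; exact: blowup_time_ge0.
apply/lee_addgt0Pr => e e0; rewrite add0e.
have /cvgr0_norm_le/(_ e e0)[m _ Hm] := eps0.
have [k mk [k2 bk]] := H m.
apply: (@le_trans _ _ (blowup_time k (x k))).
  by apply: ereal_inf_lbound; exists k => //=; exact: ltnW.
by apply: (le_trans bk); rewrite lee_fin (le_trans (ler_norm _))// Hm.
Qed.

Lemma frequently_blowup_no_solution (R : realType) (eps x : nat -> R) :
  eps @ \oo --> (0 : R) ->
  (forall m, exists2 k, (m <= k)%N &
     (2 <= k)%N /\ (blowup_time k (x k) <= (eps k)%:E)%E) ->
  forall T : R, 0 < T -> ~ exists xi : nat -> R -> R, solution T x xi.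
Proof.
move=> eps0 H T T0 [xi sol].
have /cvgr0_norm_le/(_ T T0)[m _ Hm] := eps0.
have [k mk [k2 bk]] := H m.
have [xi0 dxi] := sol k (ltnW k2).
apply: (blowup_no_solution (ltnW k2) _ xi0 dxi).
by apply: (le_trans bk); rewrite lee_fin (le_trans (ler_norm _))// Hm.
Qed.

(** * Almost sure bounds on countably many Gaussian combinations *)

(** The sum telescopes. These weights make the expectations summable over [n] in
    [ae_weighted_bound]. *)
Lemma sum_inv_mulSS_le1 (R : realType) (n : nat) :
  \sum_(0 <= k < n) ((k.+1 * k.+2)%:R)^-1 <= 1 :> R.
Proof.
suff -> : \sum_(0 <= k < n) ((k.+1 * k.+2)%:R)^-1 = 1 - n.+1%:R^-1 :> R.
  by rewrite gerBl invr_ge0.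
elim: n => [|n IH]; first by rewrite big_geq// invr1 subrr.
rewrite big_nat_recr//= IH natrM.
by field; rewrite -natrD nat1r !pnatr_eq0.
Qed.

(** A weighted sum of all the variables is integrable, hence almost surely finite, and it dominates
    each of its terms. For exponentials the weight [N n (n + 1) (n + 2)] costs only its
    logarithm. *)
Lemma ae_weighted_bound d (T : measurableType d) (R : realType)
    (P : probability T R) (g : nat -> nat -> T -> R) (N : nat -> nat) (K : R) :
  0 <= K ->
  (forall n i, measurable_fun setT (g n i)) -> (forall n i w, 0 <= g n i w) ->
  (forall n i, (i < N n)%N -> \int[P]_w (g n i w)%:E <= K%:E)%E ->
  {ae P, forall w, exists2 Z, 0 < Z & forall n i, (i < N n)%N ->
    g n i w <= Z * (N n * (n.+1 * n.+2))%:R}.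
Proof.
move=> K0 mg g0 gK.
(* The sum of all the [c n * g n i] has finite expectation. *)
pose c n : R := ((N n * (n.+1 * n.+2))%:R)^-1.
have c0 n : 0 <= c n by rewrite invr_ge0.
pose h n w : \bar R := (\sum_(i < N n) (c n * g n i w)%:E)%E.
have h0 n w : (0 <= h n w)%E by apply: sume_ge0 => i _; rewrite lee_fin mulr_ge0.
have mcg n i : measurable_fun setT (fun w => (c n * g n i w)%:E).
  by apply/measurable_EFinP; exact: measurable_funM.
have mh n : measurable_fun setT (h n) by exact: emeasurable_sum.
have hK n : (\int[P]_w h n w <= (K * ((n.+1 * n.+2)%:R)^-1)%:E)%E.
  rewrite ge0_integral_sum//; last by move=> i w _; rewrite lee_fin mulr_ge0.
  apply: (@le_trans _ _ (\sum_(i < N n) (c n * K)%:E)%E).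
    apply: lee_sum => i _; under eq_integral do rewrite EFinM.
    rewrite ge0_integralZl_EFin//.
    - by rewrite EFinM lee_wpmul2l ?lee_fin// gK.
    - by move=> w _; rewrite lee_fin.
    - exact/measurable_EFinP.
  rewrite sumEFin lee_fin sumr_const card_ord -[leLHS]mulr_natr /c.
  (* For [N n = 0] the sum is empty, while [c n] is an inverse of 0; this case is separate because
     the cancellation below divides by [N n]. *)
  have [N0|Nn] := posnP (N n); first by rewrite {2}N0 mulr0n mulr0 mulr_ge0// invr_ge0.
  rewrite le_eqVlt; apply/orP; left; apply/eqP; rewrite !natrM.
  by field; rewrite ?gt_eqF ?ltr0n.
pose F w := (\sum_(n <oo) h n w)%E.
have F0 w : (0 <= F w)%E by exact: nneseries_ge0.
have mF : measurable_fun setT F by exact: ge0_emeasurable_sum.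
have iF : P.-integrable setT F.
  apply/integrableP; split=> //.
  under eq_integral do rewrite gee0_abs//.
  rewrite integral_nneseries//; apply: (@le_lt_trans _ _ K%:E); last exact: ltry.
  apply: lime_le; first by apply: is_cvg_nneseries => n _ _; exact: integral_ge0.
  apply: nearW => n; apply: (@le_trans _ _ (\sum_(0 <= k < n) (K * ((k.+1 * k.+2)%:R)^-1)%:E)%E).
    by apply: lee_sum.
  by rewrite sumEFin lee_fin -mulr_sumr ler_piMr// sum_inv_mulSS_le1.
have := integrable_ae measurableT iF; apply: filterS => w /= /(_ I) Fw.
(* Adding 1 makes [Z] strictly positive, so that its logarithm can be taken later. *)
exists (fine (F w) + 1); first by rewrite ltr_wpDl// fine_ge0.
move=> n i iN.
have Np : 0 < (N n * (n.+1 * n.+2))%:R :> R by rewrite ltr0n muln_gt0 (leq_ltn_trans _ iN).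
rewrite -ler_pdivrMr// mulrC; apply: (@le_trans _ _ (fine (F w))); last by rewrite lerDl.
rewrite -lee_fin fineK//; apply: (@le_trans _ _ (h n w)).
  rewrite /h (bigD1 (Ordinal iN))//= leeDl// sume_ge0// => j _.
  by rewrite lee_fin mulr_ge0.
have := @nneseries_lim_ge R (fun n => h n w) xpredT 0 n.+1 (fun n _ _ => h0 n w).
apply: le_trans; rewrite big_nat_recr//= leeDr// sume_ge0//.
Qed.

(** In the denominator of [sigma], the root is at least 1 for [k >= 2], and the other factor is at
    least [1 - exp (- delta)]. *)
Lemma sigma_le_linear (R : realType) (eps : nat -> R) (delta : R) (k : nat) :
  0 < delta -> (2 <= k)%N -> delta <= k%:R ^+ 2 * eps k ->
  sigma eps k <= (1 - expR (- delta))^-1 * k%:R.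
Proof.
move=> d0 k2 dk.
have D0 : 0 < 1 - expR (- delta) by rewrite subr_gt0 expR_lt1 oppr_lt0.
have E0 : 1 - expR (- delta) <= 1 - expR (- (k%:R ^+ 2 * eps k)).
  by rewrite lerD2l lerN2 ler_expR lerN2.
have y1 : 1 <= Num.sqrt (2 * ln k%:R : R) by rewrite -[leLHS]sqrtr1 ler_wsqrtr// ln2_ge.
have E1 := lt_le_trans D0 E0; have y0 := lt_le_trans ltr01 y1.
rewrite /sigma mulrC ler_wpM2r// lef_pV2 ?posrE ?mulr_gt0//.
by rewrite (le_trans E0)// ler_peMl// ltW.
Qed.

(** A Chernoff argument: [ae_weighted_bound] applies to the exponentials of the sums divided by
    [n ^ (3 / 2)], and taking logarithms gives the bound with [z = ln Z]. *)
Lemma ae_linear_comb_le d (T : measurableType d) (R : realType)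
    (P : probability T R) (X : nat -> {RV P >-> R}) (s : nat -> R) (C : R)
    (N : nat -> nat) (a : nat -> nat -> nat -> R) :
  mutually_independent [set k | (2 <= k)%N] X ->
  (forall k, (2 <= k)%N -> 0 < s k <= C * k%:R) ->
  (forall k, (2 <= k)%N -> forall A : set R, measurable A ->
     distribution P (X k) A = normal_prob 0 (s k) A) ->
  (forall n i k, `|a n i k| <= 1) ->
  {ae P, forall w, exists z : R, forall n i, (0 < n)%N -> (i < N n)%N ->
    \sum_(2 <= k < n) a n i k * X k w <=
      n%:R * Num.sqrt n%:R * (z + ln (N n * (n.+1 * n.+2))%:R)}.
Proof.
move=> indX sC gX a1.
pose v n : R := n%:R * Num.sqrt n%:R.
have C0 : 0 <= C.
  have /andP[s0 sl] := sC 2 isT; have := le_trans (ltW s0) sl.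
  by rewrite pmulr_lge0.
pose g n i w := expR (\sum_(2 <= k < n) (a n i k / v n) * X k w).
have mg n i : measurable_fun setT (g n i).
  apply: measurableT_comp => //; apply: measurable_sum => k.
  by apply: measurable_funM => //; exact: measurable_funP.
have gK n i : (i < N n)%N -> (\int[P]_w (g n i w)%:E <= (expR (C ^+ 2 / 2))%:E)%E.
  move=> _; rewrite (integral_expR_sum (D := [set k | (2 <= k)%N]) (s := s) (fun k => a n i k / v n))//; last 3 first.
  - by move=> k /sC/andP[/gt_eqF->].
  - exact: iota_uniq.
  - by move=> k; rewrite mem_index_iota => /andP[].
  rewrite lee_fin ler_expR.
  have [n2|n2] := ltnP n 2; first by rewrite big_geq ?divr_ge0 ?sqr_ge0// ltnW.
  have n0 : 0 < n%:R :> R by rewrite ltr0n ltnW.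
  have v2 : v n ^+ 2 = n%:R ^+ 3 by rewrite exprMn sqr_sqrtr ?ltW// -exprSr.
  (* As [s k <= C n], each of the at most [n] terms is bounded by [C ^ 2 / (2 n)]. *)
  apply: (@le_trans _ _ (\sum_(2 <= k < n) C ^+ 2 / 2 / n%:R)); last first.
    rewrite sumr_const_nat -[leLHS]mulr_natr -[leLHS]mulrA ler_piMr ?divr_ge0 ?sqr_ge0//.
    by rewrite mulrC ler_pdivrMr// mul1r ler_nat leq_subr.
  rewrite big_nat_cond [leRHS]big_nat_cond; apply: ler_sum => k.
  rewrite andbT => /andP[k2 kn].
  rewrite expr_div_n v2.
  have -> : a n i k ^+ 2 / n%:R ^+ 3 * s k ^+ 2 / 2 = a n i k ^+ 2 * (s k ^+ 2 / n%:R ^+ 2) / 2 / n%:R.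
    by field; rewrite gt_eqF.
  rewrite ler_pM2r ?invr_gt0// ler_pM2r ?invr_gt0//.
  have /andP[s0 sl] := sC k k2.
  have sn : s k <= C * n%:R by rewrite (le_trans sl)// ler_wpM2l// ler_nat ltnW.
  rewrite -[leRHS]mul1r ler_pM ?sqr_ge0// ?divr_ge0 ?sqr_ge0//.
    by rewrite -real_normK ?num_real// exprn_ile1.
  rewrite ler_pdivrMr ?exprn_gt0// -exprMn ler_pXn2r// nnegrE; first exact: ltW.
  by rewrite mulr_ge0// ltW.
have := ae_weighted_bound (expR_ge0 _) mg (fun n i w => expR_ge0 _) gK.
apply: filterS => w /= [Z Z0 HZ]; exists (ln Z) => n i n0 iN.
have v0 : 0 < v n by apply: mulr_gt0; rewrite ?sqrtr_gt0 ltr0n.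
have M0 : 0 < (N n * (n.+1 * n.+2))%:R :> R by rewrite ltr0n muln_gt0 (leq_ltn_trans _ iN).
rewrite -/(v n) -ler_pdivrMl// mulr_sumr -lnM ?posrE//.
rewrite -ler_expR lnK ?posrE ?mulr_gt0//.
apply: le_trans (HZ n i iN); rewrite ler_expR le_eqVlt; apply/orP; left; apply/eqP.
by apply: eq_bigr => k _; rewrite mulrA [_ / _]mulrC.
Qed.

Lemma ae_linear_comb_norm_le d (T : measurableType d) (R : realType)
    (P : probability T R) (X : nat -> {RV P >-> R}) (s : nat -> R) (C : R)
    (N : nat -> nat) (a : nat -> nat -> nat -> R) :
  mutually_independent [set k | (2 <= k)%N] X ->
  (forall k, (2 <= k)%N -> 0 < s k <= C * k%:R) ->
  (forall k, (2 <= k)%N -> forall A : set R, measurable A ->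
     distribution P (X k) A = normal_prob 0 (s k) A) ->
  (forall n i k, `|a n i k| <= 1) ->
  {ae P, forall w, exists z : R, forall n i, (0 < n)%N -> (i < N n)%N ->
    `|\sum_(2 <= k < n) a n i k * X k w| <=
      n%:R * Num.sqrt n%:R * (z + ln (N n * (n.+1 * n.+2))%:R)}.
Proof.
move=> indX sC gX a1.
have := @ae_linear_comb_le _ _ _ _ X s C N (fun n i k => - a n i k) indX sC gX.
move=> /(_ (fun n i k => eq_ind_r (fun x => x <= 1) (a1 n i k) (normrN _))).
have := ae_linear_comb_le N indX sC gX a1.
apply: filterS2 => w /= [z1 H1] [z2 H2]; exists (Num.max z1 z2) => n i n0 iN.
have v0 : 0 <= n%:R * Num.sqrt n%:R :> R by rewrite mulr_ge0 ?sqrtr_ge0.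
rewrite ler_norml lerNl -sumrN; apply/andP; split.
  under eq_bigr do rewrite -mulNr.
  by rewrite (le_trans (H2 n i n0 iN))// ler_wpM2l// lerD2r le_max lexx orbT.
by rewrite (le_trans (H1 n i n0 iN))// ler_wpM2l// lerD2r le_max lexx.
Qed.

(** * From a grid to uniform bounds on sine sums *)

Lemma sin_lipschitz (R : realType) (x y : R) : `|sin x - sin y| <= `|x - y|.
Proof.
wlog yx : x y / y <= x.
  move=> H; have [/H//|/ltW/H] := leP y x.
  by rewrite distrC [`|y - x|]distrC.
have [c _ ->] := MVT_segment yx (fun z _ => is_derive_sin z)
  (continuous_subspaceT (@continuous_sin R)).
by rewrite normrM ler_piMl// cos_max.
Qed.

(** One shift by a multiple of [2 pi] serves all integer frequencies. The integer 8 bounds [2 pi],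
    so a grid of mesh [n ^ -6] on [[0, 8)] has [8 n ^ 6] points. *)
Lemma sin_mul_mod2pi (R : realType) (x : R) : 0 <= x ->
  exists2 y, 0 <= y < 8 & forall k : nat, sin (k%:R * x) = sin (k%:R * y).
Proof.
move=> x0; have p0 : 0 < pi *+ 2 :> R by rewrite pmulrn_lgt0 ?pi_gt0.
pose m := Num.truncn (x / (pi *+ 2)).
have /andP[mx xm] : m%:R <= x / (pi *+ 2) < m.+1%:R by apply: truncn_itv; rewrite divr_ge0// ltW.
exists (x - (pi *+ 2) *+ m).
  move: mx xm; rewrite ler_pdivlMr// ltr_pdivrMr// => mx xm; apply/andP; split.
    by rewrite subr_ge0 -mulr_natl.
  have p4 : (pi : R) *+ 2 < 8.
    have : pi < 2 * 2 :> R by rewrite -ltr_pdivrMr// pihalf_lt2.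
    by rewrite mulr2n => h; apply: lt_le_trans (ltrD h h) _; lra.
  by apply: lt_trans p4; rewrite ltrBlDr -mulrS -mulr_natl.
move=> k; rewrite -[RHS](periodicn (@sinD2pi R) (k * m)); congr sin.
move: (pi *+ 2 : R) => p.
by rewrite mulrBr mulrnAr [_ * p]mulr_natl mulrnA subrK.
Qed.

(** The coefficients [(k == n.-1)] single out the last term of a partial sum, so the bound on
    combinations controls each [b k]. The power 4 is crude: [n sqrt n <= n ^ 2], and the logarithm
    is at most [6 n ^ 2]. *)
Lemma norm_coef_le (R : realType) (b : nat -> R) (z : R) :
  (forall n, (0 < n)%N -> `|\sum_(2 <= k < n) (k == n.-1)%:R * b k| <=
     n%:R * Num.sqrt n%:R * (z + ln (1 * (n.+1 * n.+2))%:R)) ->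
  forall k, (2 <= k)%N -> `|b k| <= (`|z| + 6) * k.+1%:R ^+ 4.
Proof.
move=> H k k2; have := H k.+1 isT.
rewrite big_nat_recr//= eqxx mul1r big_nat_cond big1 ?add0r; last first.
  by move=> j /andP[/andP[_ jk] _]; rewrite (ltn_eqF jk) mul0r.
move/le_trans; apply.
set n := k.+1; have n1 : 1 <= n%:R :> R by rewrite ler1n.
have sq : Num.sqrt n%:R <= n%:R :> R.
  rewrite -[leRHS]ger0_norm// -sqrtr_sqr ler_wsqrtr// expr2 ler_peMr//.
have nn : (1 * (n.+1 * n.+2))%:R <= 6 * n%:R ^+ 2 :> R.
  rewrite mul1n natrM -(natr1 n.+1) -(natr1 n).
  by move: n1; move: (n%:R : R) => u u1; nra.
have ln_le : ln (1 * (n.+1 * n.+2))%:R <= 6 * n%:R ^+ 2 :> R.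
  by apply: le_trans nn; apply/ltW/ln_sublinear; rewrite ltr0n.
have n2 : 1 <= n%:R ^+ 2 :> R by rewrite exprn_ege1.
have h : z + ln (1 * (n.+1 * n.+2))%:R <= (`|z| + 6) * n%:R ^+ 2.
  rewrite mulrDl lerD// (le_trans (ler_norm _))// ler_peMr//.
apply: (@le_trans _ _ (n%:R * Num.sqrt n%:R * ((`|z| + 6) * n%:R ^+ 2))).
  by rewrite ler_wpM2l ?mulr_ge0 ?sqrtr_ge0.
rewrite (_ : 4 = 2 + 2)%N// exprD mulrCA ler_wpM2l ?addr_ge0// ler_wpM2r ?exprn_ge0//.
by rewrite expr2 ler_wpM2l.
Qed.

(** There are at most [n] terms; in each the sine has Lipschitz constant at most [n] and the
    coefficient is at most [K n ^ 4]. *)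
Lemma sine_sum_lipschitz (R : realType) (b : nat -> R) (K : R) (n : nat) (x y : R) :
  0 <= K -> (forall k, (2 <= k)%N -> `|b k| <= K * k.+1%:R ^+ 4) ->
  `|\sum_(2 <= k < n) sin (k%:R * x) * b k - \sum_(2 <= k < n) sin (k%:R * y) * b k|
     <= K * n%:R ^+ 6 * `|x - y|.
Proof.
move=> K0 bK; rewrite -sumrB; apply: (le_trans (ler_norm_sum _ _ _)).
apply: (@le_trans _ _ (\sum_(2 <= k < n) K * n%:R ^+ 5 * `|x - y|)); last first.
  rewrite sumr_const_nat -[leLHS]mulr_natl exprS.
  rewrite [leRHS](_ : _ = n%:R * (K * n%:R ^+ 5 * `|x - y|)); last by ring.
  by rewrite ler_wpM2r ?mulr_ge0 ?exprn_ge0// ler_nat leq_subr.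
rewrite big_nat_cond [leRHS]big_nat_cond; apply: ler_sum => k.
rewrite andbT => /andP[k2 kn].
rewrite -mulrBl normrM.
have h1 : `|sin (k%:R * x) - sin (k%:R * y)| <= n%:R * `|x - y|.
  apply: (le_trans (sin_lipschitz _ _)); rewrite -mulrBr normrM ger0_norm//.
  by rewrite ler_wpM2r// ler_nat ltnW.
have h2 : `|b k| <= K * n%:R ^+ 4.
  apply: (le_trans (bK k k2)); rewrite ler_wpM2l// ler_pXn2r ?nnegrE//.
  by rewrite ler_nat.
rewrite [leRHS](_ : _ = (n%:R * `|x - y|) * (K * n%:R ^+ 4)); last by rewrite exprS; ring.
exact: ler_pM.
Qed.

(* The Lipschitz constant [K n ^ 6] is compensated by the mesh [n ^- 6]. *)
Lemma sine_sum_le (R : realType) (b : nat -> R) (K z : R) :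
  0 <= K -> (forall k, (2 <= k)%N -> `|b k| <= K * k.+1%:R ^+ 4) ->
  (forall n i, (0 < n)%N -> (i < 8 * n ^ 6)%N ->
     `|\sum_(2 <= k < n) sin (k%:R * (i%:R / n%:R ^+ 6)) * b k| <=
       n%:R * Num.sqrt n%:R * (z + ln (8 * n ^ 6 * (n.+1 * n.+2))%:R)) ->
  forall (n : nat) x, (0 < n)%N -> `|\sum_(2 <= k < n) sin (k%:R * x) * b k| <=
    (`|z| + 48 + K) * (n%:R * Num.sqrt n%:R * (1 + ln n%:R)).
Proof.
move=> K0 bK H n x n0.
wlog x0 : x / 0 <= x.
  move=> W; have [/W//|/ltW xn] := leP 0 x.
  have : 0 <= - x by rewrite oppr_ge0.
  move/W; congr (_ <= _); rewrite -normrN -sumrN; congr `|_|.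
  by apply: eq_bigr => k _; rewrite mulrN sinN mulNr opprK.
have [y /andP[y0 y8] xy] := sin_mul_mod2pi x0.
under eq_bigr do rewrite xy.
have nR : 0 < n%:R :> R by rewrite ltr0n.
have n6 : 0 < n%:R ^+ 6 :> R by rewrite exprn_gt0.
(* [i / n ^ 6] is the last grid point not exceeding [y]; [y < 8] keeps [i] within the grid. *)
pose i := Num.truncn (y * n%:R ^+ 6).
have yn0 : 0 <= y * n%:R ^+ 6 by rewrite mulr_ge0// ltW.
have /andP[iy yi] := truncn_itv yn0.
have iN : (i < 8 * n ^ 6)%N.
  by rewrite truncn_lt_nat// natrM natrX ltr_pM2r.
have dist : `|y - i%:R / n%:R ^+ 6| <= (n%:R ^+ 6)^-1.
  rewrite ger0_norm; last by rewrite subr_ge0 ler_pdivrMr.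
  rewrite -[leRHS]mul1r ler_pdivlMr// mulrBl divfK ?gt_eqF//.
  by rewrite lerBlDr addrC natr1 ltW.
have n1 : 1 <= n%:R :> R by rewrite ler1n.
have l0 : 0 <= ln n%:R :> R by exact: ln_ge0.
have v1 : 1 <= n%:R * Num.sqrt n%:R :> R.
  by rewrite mulr_ege1// -[leLHS]sqrtr1 ler_wsqrtr.
have v0 := le_trans ler01 v1.
(* The argument is at most [48 n ^ 8], from [(n + 1) (n + 2) <= 6 n ^ 2]; then [ln 48 <= 48] and
   [8 <= 48]. *)
have lnN : ln (8 * n ^ 6 * (n.+1 * n.+2))%:R <= 48 * (1 + ln n%:R) :> R.
  apply: (@le_trans _ _ (ln (48 * n%:R ^+ 8))).
    rewrite ler_ln ?posrE ?ltr0n ?muln_gt0 ?expn_gt0 ?n0//; last by rewrite mulr_gt0 ?exprn_gt0.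
    rewrite [(8 * n ^ 6 * _)%:R]natrM [(8 * n ^ 6)%:R]natrM natrX natrM -(natr1 n.+1) -(natr1 n).
    have := exprn_ge0 6 (ltW nR); move: n1; move: (n%:R : R) => u u1 u6.
    have -> : 48 * u ^+ 8 = 8 * u ^+ 6 * (6 * u ^+ 2) by ring.
    by rewrite ler_wpM2l ?mulr_ge0//; nra.
  rewrite lnM ?posrE ?exprn_gt0// lnXn// mulrDr mulr1 lerD//.
    by apply/ltW/ln_sublinear.
  by rewrite -[leLHS]mulr_natl ler_wpM2r// ler_nat.
have := sine_sum_lipschitz n y (i%:R / n%:R ^+ 6) K0 bK.
have := H n i n0 iN.
set S1 := \sum_(_ <= _ < _) _; set S2 := \sum_(_ <= _ < _) _ => hS1 hS.
have {}hS : `|S2 - S1| <= K.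
  by apply: (le_trans hS); rewrite -mulrA ler_piMr// mulrC -ler_pdivlMr// mul1r.
rewrite -[S2](subrK S1) (le_trans (ler_normD _ _))// addrC.
apply: (le_trans (lerD hS1 hS)).
set v := n%:R * _ in v1 v0 *; set l := ln n%:R in l0 lnN *.
rewrite (_ : (_ + 48 + K) * _ = v * ((`|z| + 48) * (1 + l)) + K * (v * (1 + l))); last by ring.
apply: lerD.
  rewrite ler_wpM2l// mulrDl lerD// (le_trans (ler_norm z))// ler_peMr// lerDl//.
by rewrite ler_peMr// mulr_ege1// lerDl.
Qed.

(** * Littlewood-Paley blocks and Besov regularity *)

Lemma sum_by_parts (R : realType) (w c : nat -> R) (N : nat) :
  \sum_(k < N) w k * c k = w N * (\sum_(k < N) c k) +
    \sum_(k < N) (w k - w k.+1) * (\sum_(j < k.+1) c j).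
Proof.
elim: N => [|N IH]; first by rewrite !big_ord0 mulr0 addr0.
by rewrite !big_ord_recr/= IH; ring.
Qed.

(** By Abel summation, weights cost only their last value and their total variation. *)
Lemma norm_weighted_sum_le (R : realType) (w c : nat -> R) (N : nat) (M : R) :
  (forall m, (m <= N)%N -> `|\sum_(k < m) c k| <= M) ->
  `|\sum_(k < N) w k * c k| <= (`|w N| + \sum_(k < N) `|w k - w k.+1|) * M.
Proof.
move=> cM; rewrite sum_by_parts (le_trans (ler_normD _ _))// mulrDl lerD//.
  by rewrite normrM ler_wpM2l// cM.
rewrite (le_trans (ler_norm_sum _ _ _))// mulr_suml ler_sum// => k _.
by rewrite normrM ler_wpM2l// cM.
Qed.

Lemma smooth_lipschitz (R : realType) (f : R -> R) (A : R) : 0 <= A -> smooth f ->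
  exists2 L, 0 <= L & forall x y, 0 <= x <= A -> 0 <= y <= A ->
    `|f x - f y| <= L * `|x - y|.
Proof.
move=> A0 sf.
have df (x : R) : is_derive x (1 : R) f (derive1 f x).
  by split; [exact: (sf 0 x)|rewrite derive1E].
have cf' : continuous (derive1 f).
  by move=> x; apply/differentiable_continuous/derivable1_diffP; exact: (sf 1 x).
have cf : continuous f.
  by move=> x; apply/differentiable_continuous/derivable1_diffP; exact: (sf 0 x).
have cn : {within `[0, A], continuous (fun x => `|derive1 f x|)}.
  by apply: continuous_subspaceT => x; apply: cvg_norm; exact: cf'.
have [c _ cmax] := EVT_max A0 cn.
exists `|derive1 f c| => // x y.
wlog yx : x y / y <= x.
  move=> H xA yA; have [yx|/ltW xy] := leP y x; first exact: H.
  by rewrite distrC [`|x - y|]distrC; exact: H.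
move=> /andP[x0 xA] /andP[y0 yA].
have [z zyx ->] := MVT_segment yx (fun z _ => df z) (continuous_subspaceT cf).
rewrite normrM ler_wpM2r// cmax// in_itv/=.
by move: zyx; rewrite in_itv/= => /andP[yz zx]; rewrite (le_trans y0)//= (le_trans zx).
Qed.

(** With [e = - (s + 3 / 2) > 0], the product of [2 ^ (s i)] and [N ^ (3 / 2)] is [8 * 2 ^ (- e i)],
    whose decay beats [1 + ln N], which is linear in [i]. *)
Lemma dyadic_growth (R : realType) (s : R) : s < - (3 / 2) ->
  exists2 C, 0 <= C & forall i N : nat, N = (2 ^ i.+2)%N ->
    2 `^ (s * i%:R) * (N%:R * Num.sqrt N%:R * (1 + ln N%:R)) <= C :> R.
Proof.
move=> s32; pose e := - (s + 3 / 2); have e0 : 0 < e by rewrite /e; lra.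
have l0 : 0 < ln 2 :> R by rewrite ln_gt0// ltr1n.
have l1 : ln 2 <= 2 :> R by exact/ltW/ln_sublinear.
have el0 : 0 < e * ln 2 by rewrite mulr_gt0.
(* [1 + ln N <= 5 + 2 i] because [ln 2 <= 2], and [i] is at most [exp (e i ln 2) / (e ln 2)]. *)
pose C0 := 5 + 2 / (e * ln 2).
exists (expR (3 * ln 2) * C0).
  by rewrite mulr_ge0 ?expR_ge0// addr_ge0// divr_ge0// ltW.
move=> i N NE2.
have NE : N%:R = expR (i.+2%:R * ln 2) :> R.
  by rewrite mulrC expRM_natr lnK ?posrE// NE2 natrX.
have sN : Num.sqrt N%:R = expR (i.+2%:R * ln 2 / 2) :> R.
  rewrite NE -[RHS]ger0_norm ?expR_ge0// -sqrtr_sqr -expRM_natr; congr (Num.sqrt (expR _)).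
  by field.
have powE : 2 `^ (s * i%:R) = expR (s * i%:R * ln 2) :> R by rewrite /powR ifF// pnatr_eq0.
have E : 2 `^ (s * i%:R) * (N%:R * Num.sqrt N%:R) = expR (3 * ln 2) / expR (e * ln 2 * i%:R).
  rewrite powE sN {1}NE -!expRD -expRN -expRD; congr expR.
  by rewrite /e -(natr1 i.+1) -(natr1 i); field.
rewrite mulrA E -mulrA ler_wpM2l ?expR_ge0// mulrC ler_pdivrMr ?expR_gt0//.
have lN : 1 + ln N%:R <= 5 + 2 * i%:R :> R.
  rewrite NE expRK -(natr1 i.+1) -(natr1 i).
  have : 0 <= i%:R :> R by rewrite ler0n.
  move: (i%:R : R) (ln 2 : R) l0 l1 => u l l0' l1' u0; nra.
apply: (le_trans lN).
have : 1 + e * ln 2 * i%:R <= expR (e * ln 2 * i%:R) by exact: expR_ge1Dx.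
set q := expR _ => q1.
have i0 : 0 <= e * ln 2 * i%:R by rewrite mulr_ge0// ltW.
have q0 : 1 <= q by lra.
rewrite /C0 [leRHS]mulrDl lerD//; first by rewrite ler_peMr.
rewrite mulrAC ler_pdivlMr// -mulrA ler_wpM2l// mulrC; lra.
Qed.

(* The bound on partial sums does not depend on the dyadic partition: summation by
   parts against the Lipschitz weight [k |-> rho (k / 2 ^ i)] transfers it to
   every block. *)
Lemma norm_lp_block_le (R : realType) (chi rho : R -> R) (b : nat -> R) (K : R) :
  dyadic_partition chi rho -> (forall k, (k < 2)%N -> b k = 0) ->
  (forall (n : nat) x, (0 < n)%N -> `|\sum_(2 <= k < n) sin (k%:R * x) * b k| <=
    K * (n%:R * Num.sqrt n%:R * (1 + ln n%:R))) ->
  exists2 L, 0 <= L & forall (i N : nat) x, N = (2 ^ i.+2)%N ->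
    `|lp_block chi rho (sine_series b) i.+1 x| <=
      L * (N%:R * Num.sqrt N%:R * (1 + ln N%:R)).
Proof.
move=> D b0 bK.
(* The arguments [k / 2 ^ i] with [k <= N] lie in [[0, 4]], since [N = 4 * 2 ^ i]. *)
have [L L0 rhoL] := smooth_lipschitz (ltW (ltr0Sn R 3)) (rho_smooth D).
(* At [n = 1] the sum is empty and the factor of [K] is 1. *)
have K0 : 0 <= K.
  by have := bK 1%N 0 isT; rewrite big_geq// normr0 ln1 addr0 sqrtr1 !mulr1.
(* The weight makes [N = 4 * 2 ^ i] steps of size at most [L / 2 ^ i], so its total variation is at
   most [4 L]. *)
exists (4 * L * K) => [|i N x NE2]; first by rewrite !mulr_ge0.
pose phi n : R := n%:R * Num.sqrt n%:R * (1 + ln n%:R).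
have phi0 n : (0 < n)%N -> 0 <= phi n.
  by move=> n0; rewrite !mulr_ge0 ?sqrtr_ge0// addr_ge0// ln_ge0// ler1n.
have phi_le m n : (0 < m)%N -> (m <= n)%N -> phi m <= phi n.
  move=> m0 mn; have n0 := leq_trans m0 mn.
  rewrite /phi !ler_pM ?mulr_ge0 ?sqrtr_ge0 ?addr_ge0 ?ln_ge0 ?ler1n ?ler_nat//.
    by rewrite ler_wsqrtr// ler_nat.
  by rewrite lerD2l ler_ln ?posrE ?ltr0n// ler_nat.
have N0 : (0 < N)%N by rewrite NE2 expn_gt0.
pose c k : R := sin (k%:R * x) * b k.
have cM m : (m <= N)%N -> `|\sum_(k < m) c k| <= K * phi N.
  move=> mN; have [m2|m2] := leqP m 2.
    rewrite big1 => [|k _]; first by rewrite normr0; apply: mulr_ge0 => //; exact: phi0.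
    by rewrite /c b0 ?mulr0// (leq_trans (ltn_ord k)).
  have m1 : (1 < m)%N by exact: ltnW.
  rewrite -(big_mkord xpredT c) (big_ltn (ltnW m1)) (big_ltn m1) /c !b0// !mulr0 !add0r.
  apply: (le_trans (bK m x _)); first by rewrite (leq_trans _ m2).
  by rewrite ler_wpM2l// phi_le// (leq_trans _ m2).
have two0 : 0 < 2 ^+ i :> R by rewrite exprn_gt0.
pose w k : R := rho (k%:R / 2 ^+ i).
have -> : lp_block chi rho (sine_series b) i.+1 x = \sum_(k < N) w k * c k.
  by rewrite NE2; apply: eq_bigr => k _; rewrite /= mul0r add0r [b k * _]mulrC.
apply: (le_trans (norm_weighted_sum_le w cM)).
have in04 k : (k <= N)%N -> 0 <= (k%:R / 2 ^+ i : R) <= 4.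
  move=> kN; rewrite divr_ge0 ?exprn_ge0//= ler_pdivrMr//.
  have -> : 4 * 2 ^+ i = N%:R :> R by rewrite NE2 natrX !exprS; ring.
  by rewrite ler_nat.
rewrite -/(phi N) -[leRHS]mulrA; apply: ler_wpM2r; first by apply: mulr_ge0 => //; exact: phi0.
(* The boundary term vanishes: [w N = rho 4] and [4 >= 8 / 3]. *)
have -> : w N = 0.
  apply: (rho_supp D); right; rewrite ger0_norm ?divr_ge0 ?exprn_ge0//.
  rewrite ler_pdivlMr// NE2 natrX !exprS; nra.
rewrite normr0 add0r; apply: (@le_trans _ _ (\sum_(k < N) L / 2 ^+ i)).
  apply: ler_sum => k _; apply: (le_trans (rhoL _ _ (in04 _ _) (in04 _ _))) => //.
    exact: ltnW.
  rewrite -mulrBl normrM distrC -natr1 addrAC subrr add0r normr1 mul1r.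
  by rewrite gtr0_norm// invr_gt0.
rewrite sumr_const card_ord -[leLHS]mulr_natl NE2 natrX !exprS.
by rewrite le_eqVlt; apply/orP; left; apply/eqP; field; rewrite gt_eqF.
Qed.

Lemma sine_series_in_besov_minus (R : realType) (b : nat -> R) (K0 K : R) :
  (forall k, (k < 2)%N -> b k = 0) ->
  (forall k, (2 <= k)%N -> `|b k| <= K0 * k.+1%:R ^+ 4) ->
  (forall (n : nat) x, (0 < n)%N -> `|\sum_(2 <= k < n) sin (k%:R * x) * b k| <=
    K * (n%:R * Num.sqrt n%:R * (1 + ln n%:R))) ->
  in_besov_minus (- (3 / 2)) (sine_series b).
Proof.
move=> b0 bK0 bK s s32; split.
  exists `|K0|, 4%N => k /=; split; first by rewrite normr0 mulr_ge0.
  have [k2|k2] := ltnP k 2; first by rewrite b0// normr0 mulr_ge0.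
  by rewrite (le_trans (bK0 k k2))// ler_wpM2r ?ler_norm.
move=> chi rho D; have [L L0 HL] := norm_lp_block_le D b0 bK.
have [C C0 HC] := dyadic_growth s32.
apply: (@le_lt_trans _ _ (L * C)%:E); last exact: ltry.
apply: ge_ereal_sup => _ [[|i] _ <-].
  (* The first block involves only [k = 0] and [k = 1], whose coefficients are zero. *)
  apply: (@le_trans _ _ ((2 `^ (s * (0 - 1)))%:E * 0)%E).
    rewrite lee_wpmul2l ?lee_fin ?powR_ge0//.
    apply: ge_ereal_sup => _ [x _ <-]; rewrite lee_fin.
    by rewrite /lp_block !big_ord_recr big_ord0/= !b0// !(mul0r, mulr0, addr0) normr0.
  by rewrite mule0 lee_fin mulr_ge0.
have N0 : (0 : R) <= (2 ^ i.+2)%:R by [].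
set N := (2 ^ i.+2)%N in N0; pose B := L * (N%:R * Num.sqrt N%:R * (1 + ln N%:R)).
apply: (@le_trans _ _ ((2 `^ (s * i%:R))%:E * B%:E)%E).
  rewrite (_ : i.+1%:R - 1 = i%:R); last by rewrite -natr1 addrK.
  rewrite lee_wpmul2l ?lee_fin ?powR_ge0//.
  by apply: ge_ereal_sup => _ [x _ <-]; rewrite lee_fin; exact: HL.
by rewrite -EFinM lee_fin mulrCA ler_wpM2l// HC.
Qed.

Lemma ae_sine_series_in_besov d (T : measurableType d) (R : realType)
    (P : probability T R) (X : nat -> {RV P >-> R}) (s : nat -> R) (C : R) :
  mutually_independent [set k | (2 <= k)%N] X ->
  (forall k, (2 <= k)%N -> 0 < s k <= C * k%:R) ->
  (forall k, (2 <= k)%N -> forall A : set R, measurable A ->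
     distribution P (X k) A = normal_prob 0 (s k) A) ->
  {ae P, forall w, in_besov_minus (- (3 / 2))
     (sine_series (fun k => if (2 <= k)%N then X k w else 0))}.
Proof.
move=> indX sC gX.
have delta_le1 (n i k : nat) : `|(k == n.-1)%:R| <= 1 :> R.
  by case: eqP; rewrite ?normr1 ?normr0.
(* Two families of combinations are used: single coefficients, for polynomial growth, and sines at
   the grid points, for the partial sums. *)
have coef := @ae_linear_comb_norm_le _ _ _ P X s C (fun=> 1%N)
  (fun n _ k => (k == n.-1)%:R) indX sC gX delta_le1.
have grid := @ae_linear_comb_norm_le _ _ _ P X s C (fun n => 8 * n ^ 6)%N
  (fun n i k => sin (k%:R * (i%:R / n%:R ^+ 6))) indX sC gX (fun _ _ _ => sin_max _).
move: coef grid; apply: filterS2 => w /= [z1 H1] [z2 H2].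
set b := fun k : nat => _.
have bE (a : nat -> R) n : \sum_(2 <= k < n) a k * X k w = \sum_(2 <= k < n) a k * b k.
  by apply: eq_big_nat => k /andP[k2 _]; rewrite /b k2.
have bK : forall k, (2 <= k)%N -> `|b k| <= (`|z1| + 6) * k.+1%:R ^+ 4.
  by apply: norm_coef_le => n n0; rewrite -bE; exact: (H1 n 0%N n0 isT).
apply: (sine_series_in_besov_minus _ bK).
  by move=> k k2; rewrite /b leqNgt k2.
apply: (sine_sum_le (z := z2) _ bK); first by rewrite addr_ge0.
by move=> n i n0 iN; rewrite -(bE (fun k => sin (k%:R * _))); exact: H2.
Qed.

(** * Assembly of the four claims *)

Theorem lemma5p2 (R : realType) (d : measure_display) (Omega : measurableType d)
    (P : probability Omega R) (eps : nat -> R) (X : nat -> {RV P >-> R})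
    (eps_gt0 : forall k, (2 <= k)%N -> 0 < eps k)
    (eps_noninc : forall k l, (2 <= k <= l)%N -> eps l <= eps k)
    (eps_cvg0 : eps @ \oo --> (0 : R))
    (X_gauss : forall k, (2 <= k)%N ->
      forall A : set R, measurable A ->
        distribution P (X k) A = normal_prob 0 (sigma eps k) A)
    (X_indep : mutually_independent [set k | (2 <= k)%N] X) :
  let xi0 (w : Omega) (k : nat) : R := if (2 <= k)%N then X k w else 0 in
  let tau (w : Omega) (k : nat) : \bar R := blowup_time k (xi0 w k) in
  [/\ {ae P, forall w,
         infinite_set [set k | (2 <= k)%N /\ (tau w k <= (eps k)%:E)%E]},
      {ae P, forall w, ereal_inf [set tau w k | k in [set k | (1 <= k)%N]] = 0%E},
      {ae P, forall w, forall T : R, 0 < T ->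
         ~ exists xi : nat -> R -> R, solution T (xi0 w) xi} &
      0 < inf [set k%:R ^+ 2 * eps k | k in [set k | (2 <= k)%N]] ->
         {ae P, forall w, in_besov_minus (- (3 / 2)) (sine_series (xi0 w))}].
Proof.
move=> xi0 tau.
have xi0E w k : (2 <= k)%N -> xi0 w k = X k w by rewrite /xi0 => ->.
(* The first three claims hold on this single event of full probability. *)
have often : {ae P, forall w, forall m, exists2 k, (m <= k)%N &
    (2 <= k)%N /\ (blowup_time k (xi0 w k) <= (eps k)%:E)%E}.
  apply: filterS (ae_frequently_blowup eps_gt0 X_gauss X_indep) => w H m.
  by have [k mk [k2 bk]] := H m; exists k => //; rewrite xi0E.
split.
- by apply: filterS often => w H; exact: infinite_set_frequently.
- by apply: filterS often => w H; exact: ereal_inf_blowup_time H.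
- by apply: filterS often => w H; exact: frequently_blowup_no_solution H.
- set S := [set _ | k in _] => d0.
  (* Positivity of the terms makes 0 a lower bound of [S], so that [inf S] is a genuine infimum; it
     then serves as [delta]. *)
  have infS k : (2 <= k)%N -> inf S <= k%:R ^+ 2 * eps k.
    move=> k2; apply: ge_inf; last by exists k.
    by exists 0 => _ [j j2 <-]; rewrite mulr_ge0 ?exprn_ge0// ltW// eps_gt0.
  apply: (ae_sine_series_in_besov (C := (1 - expR (- inf S))^-1) X_indep _ X_gauss).
  move=> k k2; rewrite sigma_gt0 ?eps_gt0//=.
  by apply: sigma_le_linear => //; exact: infS.
Qed.
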